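(* Let $\mathbf{Lex}_0$ be the 2-category of finitely complete categories admitting an initial object, left-exact functors between such categories and natural transformations between such functors. Let $\mathbf{Lex}_*$ be the full 2-subcategory of $\mathbf{Lex}_0$ generated by the pointed finitely complete categories. Then the assignment $\mathcal A\mapsto \mathcal A/0_{\mathcal A}$, sending a category $\mathcal A\in\mathbf{Lex}_0$ to its slice over its initial object $0_{\mathcal A}$ (which is an object of $\mathbf{Lex}_*$), can be extended to a pseudofunctor $S\colon \mathbf{Lex}_0\to\mathbf{Lex}_*$ which is left biadjoint to the inclusion $\mathbf{Lex}_*\hookrightarrow\mathbf{Lex}_0$, and such that the component along $\mathcal A\in\mathbf{Lex}_0$ of the unit of this biadjunction is given by the pullback functor $p^*\colon\mathcal A\to\mathcal A/0_{\mathcal A}$, where $p\colon 0_{\mathcal A}\to 1_{\mathcal A}$ is the unique morphism from the initial to the terminal object of $\mathcal A$.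
   Context: A functor is left-exact if it preserves finite limits (it is not required to preserve initial objects). A category is pointed if it has a zero object, i.e. an object that is both initial and terminal. For every category $\mathcal A$ in $\mathbf{Lex}_0$ an initial object $0_{\mathcal A}$, a terminal object $1_{\mathcal A}$ and the relevant pullbacks are assumed chosen. Objects of $\mathcal A/0_{\mathcal A}$ are pairs $(A,a)$ with $a\colon A\to 0_{\mathcal A}$ in $\mathcal A$. Identifying $\mathcal A$ with $\mathcal A/1_{\mathcal A}$, the functor $p^*\colon\mathcal A\to\mathcal A/0_{\mathcal A}$ sends $A$ to $(A\times 0_{\mathcal A},\ \pi_0\colon A\times 0_{\mathcal A}\to 0_{\mathcal A})$, where $\pi_0$ is the product projection. *)

(* Defs.v *)
From Stdlib Require Import FinFun FunctionalExtensionality ProofIrrelevance.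
From Stdlib Require Import IndefiniteDescription.

Set Implicit Arguments.
Unset Strict Implicit.
Unset Printing Implicit Defensive.

Declare Scope cat_scope.
Delimit Scope cat_scope with cat.
Open Scope cat_scope.

Record Category := {
  ob :> Type;
  hom : ob -> ob -> Type;
  idm : forall x, hom x x;
  cmp : forall x y z, hom y z -> hom x y -> hom x z;
  cmp_idl : forall x y (f : hom x y), cmp (idm y) f = f;
  cmp_idr : forall x y (f : hom x y), cmp f (idm x) = f;
  cmp_assoc : forall x y z w (h : hom z w) (g : hom y z) (f : hom x y),
    cmp (cmp h g) f = cmp h (cmp g f)
}.
Arguments hom {_} _ _.
Arguments idm {_} _.
Arguments cmp {_ _ _ _} _ _.

Notation "g ∘ f" := (cmp g f) (at level 40, left associativity) : cat_scope.

Record Functor (A B : Category) := {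
  fob :> A -> B;
  fmap : forall x y : A, hom x y -> hom (fob x) (fob y);
  fmap_id : forall x, fmap (idm x) = idm (fob x);
  fmap_cmp : forall x y z (g : hom y z) (f : hom x y),
    fmap (g ∘ f) = fmap g ∘ fmap f
}.
Arguments fmap {_ _} _ {_ _} _.

Definition functor_id (A : Category) : Functor A A.
Proof.
  refine {| fob := fun x => x; fmap := fun _ _ f => f |}; reflexivity.
Defined.

Definition functor_comp (A B C : Category) (G : Functor B C) (F : Functor A B) :
  Functor A C.
Proof.
  refine {| fob := fun x => G (F x); fmap := fun _ _ f => fmap G (fmap F f) |}.
  - intros; rewrite !fmap_id; reflexivity.
  - intros; rewrite !fmap_cmp; reflexivity.
Defined.

Record NatTrans (A B : Category) (F G : Functor A B) := {
  nt :> forall x, hom (F x) (G x);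
  nt_nat : forall x y (f : hom x y), nt y ∘ fmap F f = fmap G f ∘ nt x
}.

Lemma nat_trans_eq (A B : Category) (F G : Functor A B) (s t : NatTrans F G) :
  (forall x, s x = t x) -> s = t.
Proof.
  destruct s as [s Hs], t as [t Ht]; simpl; intro H.
  assert (s = t) by (extensionality x; apply H); subst.
  f_equal; apply proof_irrelevance.
Qed.

Definition FunCat (A B : Category) : Category.
Proof.
  unshelve refine {|
    ob := Functor A B;
    hom := @NatTrans A B;
    idm := fun F => {| nt := fun x => idm (F x) |};
    cmp := fun F G H t s => {| nt := fun x => t x ∘ s x |} |}.
  - intros; rewrite cmp_idl, cmp_idr; reflexivity.
  - intros; rewrite cmp_assoc, nt_nat, <- cmp_assoc, nt_nat, cmp_assoc; reflexivity.
  - intros; apply nat_trans_eq; intro; apply cmp_idl.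
  - intros; apply nat_trans_eq; intro; apply cmp_idr.
  - intros; apply nat_trans_eq; intro; apply cmp_assoc.
Defined.

Definition FullSubcategory (C : Category) (P : C -> Prop) : Category.
Proof.
  refine {|
    ob := {x : C | P x};
    hom := fun x y => hom (proj1_sig x) (proj1_sig y);
    idm := fun x => idm (proj1_sig x);
    cmp := fun _ _ _ g f => g ∘ f |}.
  - intros; apply cmp_idl.
  - intros; apply cmp_idr.
  - intros; apply cmp_assoc.
Defined.

Record Iso (C : Category) (x y : C) := {
  iso_fwd :> hom x y;
  iso_bwd : hom y x;
  iso_bwd_fwd : iso_bwd ∘ iso_fwd = idm x;
  iso_fwd_bwd : iso_fwd ∘ iso_bwd = idm y
}.

Definition IsEquivalence (A B : Category) (F : Functor A B) : Prop :=
  exists G : Functor B A,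
    inhabited (Iso (C := FunCat A A) (functor_comp G F) (functor_id A)) /\
    inhabited (Iso (C := FunCat B B) (functor_comp F G) (functor_id B)).

Definition IsTerminal (C : Category) (x : C) : Prop :=
  forall y : C, exists! f : hom y x, True.

Definition IsInitial (C : Category) (x : C) : Prop :=
  forall y : C, exists! f : hom x y, True.

Definition HasInitial (C : Category) : Prop := exists x : C, IsInitial x.

Definition Pointed (C : Category) : Prop :=
  exists x : C, IsInitial x /\ IsTerminal x.

Definition FiniteCategory (J : Category) : Prop :=
  Finite J /\ forall i j : J, Finite (hom i j).

Record Cone (J A : Category) (D : Functor J A) := {
  apex : A;
  leg : forall j, hom apex (D j);
  leg_nat : forall i j (f : hom i j), fmap D f ∘ leg i = leg j
}.
Arguments leg {_ _ _} _ _.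

Definition IsLimit (J A : Category) (D : Functor J A) (c : Cone D) : Prop :=
  forall c' : Cone D,
    exists! u : hom (apex c') (apex c), forall j, leg c j ∘ u = leg c' j.

Definition cone_image (J A B : Category) (F : Functor A B) (D : Functor J A)
  (c : Cone D) : Cone (functor_comp F D).
Proof.
  refine (@Build_Cone J B (functor_comp F D)
            (F (apex c)) (fun j => fmap F (leg c j)) _).
  intros; simpl; rewrite <- fmap_cmp, leg_nat; reflexivity.
Defined.

Definition FinitelyComplete (A : Category) : Prop :=
  forall J : Category, FiniteCategory J ->
  forall D : Functor J A, exists c : Cone D, IsLimit c.

Definition LeftExact (A B : Category) (F : Functor A B) : Prop :=
  forall J : Category, FiniteCategory J ->
  forall (D : Functor J A) (c : Cone D), IsLimit c -> IsLimit (cone_image F c).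

Lemma left_exact_id (A : Category) : LeftExact (functor_id A).
Proof.
  intros J HJ D c Hc [a l n].
  exact (Hc (@Build_Cone J A D a l n)).
Qed.

Lemma left_exact_comp (A B C : Category) (G : Functor B C) (F : Functor A B) :
  LeftExact G -> LeftExact F -> LeftExact (functor_comp G F).
Proof.
  intros HG HF J HJ D c Hc [a l n].
  exact (HG J HJ _ _ (HF J HJ D c Hc)
           (@Build_Cone J C (functor_comp G (functor_comp F D)) a l n)).
Qed.

Definition the (T : Type) (P : T -> Prop) (H : exists! x, P x) : T :=
  proj1_sig (constructive_definite_description P H).

Lemma the_spec (T : Type) (P : T -> Prop) (H : exists! x, P x) : P (the H).
Proof. exact (proj2_sig (constructive_definite_description P H)). Qed.

Record Pullback (C : Category) (x y z : C) (f : hom x z) (g : hom y z) := {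
  pb :> C;
  pb1 : hom pb x;
  pb2 : hom pb y;
  pb_comm : f ∘ pb1 = g ∘ pb2;
  pb_univ : forall (w : C) (h : hom w x) (k : hom w y), f ∘ h = g ∘ k ->
    exists! u : hom w pb, pb1 ∘ u = h /\ pb2 ∘ u = k
}.

Lemma pb_uniq (C : Category) (x y z : C) (f : hom x z) (g : hom y z)
  (p : Pullback f g) (w : C) (u v : hom w p) :
  pb1 p ∘ u = pb1 p ∘ v -> pb2 p ∘ u = pb2 p ∘ v -> u = v.
Proof.
  intros H1 H2.
  destruct (@pb_univ _ _ _ _ _ _ p w (pb1 p ∘ v) (pb2 p ∘ v)) as [t [_ Ht]].
  - rewrite <- !cmp_assoc, pb_comm; reflexivity.
  - rewrite <- (Ht u), <- (Ht v); auto.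
Qed.

Record Chosen (A : Category) := {
  zero : A;
  zero_initial : IsInitial zero;
  one : A;
  one_terminal : IsTerminal one;
  pullback : forall (x y z : A) (f : hom x z) (g : hom y z), Pullback f g
}.

Record SliceOb (A : Category) (x : A) := {
  slice_dom : A;
  slice_map : hom slice_dom x
}.

Record SliceHom (A : Category) (x : A) (s t : SliceOb x) := {
  slice_hom : hom (slice_dom s) (slice_dom t);
  slice_hom_comm : slice_map t ∘ slice_hom = slice_map s
}.

Lemma slice_hom_eq (A : Category) (x : A) (s t : SliceOb x) (f g : SliceHom s t) :
  slice_hom f = slice_hom g -> f = g.
Proof.
  destruct f as [f Hf], g as [g Hg]; simpl; intro H; subst.
  f_equal; apply proof_irrelevance.
Qed.

Definition Slice (A : Category) (x : A) : Category.
Proof.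
  unshelve refine {|
    ob := SliceOb x;
    hom := @SliceHom A x;
    idm := fun s => {| slice_hom := idm (slice_dom s) |};
    cmp := fun r s t g f => {| slice_hom := slice_hom g ∘ slice_hom f |} |}.
  - apply cmp_idr.
  - rewrite <- cmp_assoc, !slice_hom_comm; reflexivity.
  - intros; apply slice_hom_eq, cmp_idl.
  - intros; apply slice_hom_eq, cmp_idr.
  - intros; apply slice_hom_eq, cmp_assoc.
Defined.

(** The pullback functor [f^* : A/y -> A/x] along [f : x -> y]; an object
    [(a, s)] is sent to the first projection of the pullback of [f] and [s]. *)
Section PullbackFunctor.
Context (A : Category) (ch : Chosen A) (x y : A) (f : hom x y).

Definition pullback_ob (s : Slice y) : Slice x :=
  {| slice_dom := pullback ch f (slice_map s);
     slice_map := pb1 (pullback ch f (slice_map s)) |}.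

Lemma pullback_hom_comm (s t : Slice y) (h : hom s t) :
  f ∘ pb1 (pullback ch f (slice_map s)) =
  slice_map t ∘ (slice_hom h ∘ pb2 (pullback ch f (slice_map s))).
Proof. rewrite <- cmp_assoc, slice_hom_comm; apply pb_comm. Qed.

Definition pullback_hom (s t : Slice y) (h : hom s t) :
  hom (pullback_ob s) (pullback_ob t) :=
  let u := pb_univ (pullback ch f (slice_map t)) (pullback_hom_comm h) in
  {| slice_hom := the u : hom (slice_dom (pullback_ob s)) (slice_dom (pullback_ob t));
     slice_hom_comm := proj1 (the_spec u) |}.

Lemma pullback_hom_pb2 (s t : Slice y) (h : hom s t) :
  pb2 (pullback ch f (slice_map t)) ∘ slice_hom (pullback_hom h) =
  slice_hom h ∘ pb2 (pullback ch f (slice_map s)).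
Proof. exact (proj2 (the_spec (pb_univ _ (pullback_hom_comm h)))). Qed.

Definition pullback_functor : Functor (Slice y) (Slice x).
Proof.
  refine {| fob := pullback_ob; fmap := pullback_hom |}.
  - intro s; apply slice_hom_eq, pb_uniq.
    + etransitivity; [apply (slice_hom_comm (pullback_hom (idm s)))|].
      symmetry; apply cmp_idr.
    + rewrite pullback_hom_pb2; simpl; rewrite cmp_idl, cmp_idr; reflexivity.
  - intros r s t h g; apply slice_hom_eq, pb_uniq.
    + etransitivity; [apply (slice_hom_comm (pullback_hom (h ∘ g)))|].
      symmetry; apply (slice_hom_comm (pullback_hom h ∘ pullback_hom g)).
    + rewrite pullback_hom_pb2; simpl.
      etransitivity; [apply cmp_assoc|].
      etransitivity; [apply f_equal, eq_sym, (pullback_hom_pb2 g)|].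
      etransitivity; [symmetry; apply cmp_assoc|].
      etransitivity; [apply f_equal2; [symmetry; apply (pullback_hom_pb2 h)|reflexivity]|].
      apply cmp_assoc.
Defined.

End PullbackFunctor.

(** The identification of [A] with [A/1]. *)
Section ToSliceOne.
Context (A : Category) (ch : Chosen A).

Definition to_slice_one_ob (a : A) : Slice (one ch) :=
  {| slice_dom := a; slice_map := the (one_terminal ch a) |}.

Definition to_slice_one_hom (a b : A) (f : hom a b) :
  hom (to_slice_one_ob a) (to_slice_one_ob b).
Proof.
  refine (@Build_SliceHom A (one ch) (to_slice_one_ob a) (to_slice_one_ob b) f _).
  simpl; destruct (one_terminal ch a) as [t Ht].
  transitivity t; [symmetry|]; apply Ht; exact I.
Defined.

Definition to_slice_one : Functor A (Slice (one ch)).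
Proof.
  refine {| fob := to_slice_one_ob; fmap := to_slice_one_hom |};
    intros; apply slice_hom_eq; reflexivity.
Defined.

End ToSliceOne.

(** For [p : 0 -> 1], the object [p^* a] is the pullback of [p] and [a -> 1], that
    is, the product of [0] and [a] with its projection to [0]. *)
Definition pstar (A : Category) (ch : Chosen A) : Functor A (Slice (zero ch)) :=
  functor_comp (pullback_functor ch (the (zero_initial ch (one ch))))
    (to_slice_one ch).

Reserved Notation "g ⊙ f" (at level 40, left associativity).
Reserved Notation "b ⋆ a" (at level 40, left associativity).

Record Bicategory := {
  bob :> Type;
  bhom : bob -> bob -> Category;
  id1 : forall x, bhom x x;
  cmp1 : forall x y z, bhom y z -> bhom x y -> bhom x z
    where "g ⊙ f" := (cmp1 g f);
  hcmp : forall x y z (g g' : bhom y z) (f f' : bhom x y),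
    hom g g' -> hom f f' -> hom (g ⊙ f) (g' ⊙ f')
    where "b ⋆ a" := (hcmp b a);
  hcmp_id : forall x y z (g : bhom y z) (f : bhom x y),
    idm g ⋆ idm f = idm (g ⊙ f);
  hcmp_cmp : forall x y z (g g' g'' : bhom y z) (f f' f'' : bhom x y)
    (b' : hom g' g'') (b : hom g g') (a' : hom f' f'') (a : hom f f'),
    (b' ∘ b) ⋆ (a' ∘ a) = (b' ⋆ a') ∘ (b ⋆ a);
  assoc : forall x y z w (h : bhom z w) (g : bhom y z) (f : bhom x y),
    Iso (h ⊙ g ⊙ f) (h ⊙ (g ⊙ f));
  lunit : forall x y (f : bhom x y), Iso (id1 y ⊙ f) f;
  runit : forall x y (f : bhom x y), Iso (f ⊙ id1 x) f;
  assoc_nat : forall x y z w (h h' : bhom z w) (g g' : bhom y z) (f f' : bhom x y)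
    (c : hom h h') (b : hom g g') (a : hom f f'),
    assoc h' g' f' ∘ (c ⋆ b ⋆ a) = (c ⋆ (b ⋆ a)) ∘ assoc h g f;
  lunit_nat : forall x y (f f' : bhom x y) (a : hom f f'),
    lunit f' ∘ (idm (id1 y) ⋆ a) = a ∘ lunit f;
  runit_nat : forall x y (f f' : bhom x y) (a : hom f f'),
    runit f' ∘ (a ⋆ idm (id1 x)) = a ∘ runit f;
  triangle : forall x y z (g : bhom y z) (f : bhom x y),
    (idm g ⋆ lunit f) ∘ assoc g (id1 y) f = runit g ⋆ idm f;
  pentagon : forall v w x y z (k : bhom y z) (h : bhom x y) (g : bhom w x)
    (f : bhom v w),
    assoc k h (g ⊙ f) ∘ assoc (k ⊙ h) g f =
    (idm k ⋆ assoc h g f) ∘ assoc k (h ⊙ g) f ∘ (assoc k h g ⋆ idm f)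
}.
Arguments bhom {_} _ _.
Arguments id1 {_} _.
Arguments cmp1 {_ _ _ _} _ _.
Arguments hcmp {_ _ _ _ _ _ _ _} _ _.
Arguments assoc {_ _ _ _ _} _ _ _.
Arguments lunit {_ _ _} _.
Arguments runit {_ _ _} _.

Notation "g ⊙ f" := (cmp1 g f) : cat_scope.
Notation "b ⋆ a" := (hcmp b a) : cat_scope.

Definition eq_hom (C : Category) (x y : C) (e : x = y) : hom x y :=
  match e with eq_refl => idm x end.

(** A 2-category is a bicategory in which composition of 1-cells is strictly
    associative and unital, the constraint cells being the identities. *)
Record TwoCategory := {
  bicat :> Bicategory;
  strict_assoc : forall (x y z w : bicat) (h : bhom z w) (g : bhom y z)
    (f : bhom x y),
    exists e : h ⊙ g ⊙ f = h ⊙ (g ⊙ f), iso_fwd (assoc h g f) = eq_hom e;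
  strict_lunit : forall (x y : bicat) (f : bhom x y),
    exists e : id1 y ⊙ f = f, iso_fwd (lunit f) = eq_hom e;
  strict_runit : forall (x y : bicat) (f : bhom x y),
    exists e : f ⊙ id1 x = f, iso_fwd (runit f) = eq_hom e
}.

Definition nat_iso_id (A B : Category) (F G : Functor A B)
  (s : forall x, hom (F x) (G x)) (t : forall x, hom (G x) (F x))
  (Hs : forall x y (f : hom x y), s y ∘ fmap F f = fmap G f ∘ s x)
  (Ht : forall x y (f : hom x y), t y ∘ fmap G f = fmap F f ∘ t x)
  (Hts : forall x, t x ∘ s x = idm (F x)) (Hst : forall x, s x ∘ t x = idm (G x)) :
  Iso (C := FunCat A B) F G.
Proof.
  refine (@Build_Iso (FunCat A B) F G {| nt := s; nt_nat := Hs |}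
            {| nt := t; nt_nat := Ht |} _ _);
    apply nat_trans_eq; assumption.
Defined.

Definition nat_hcomp (A B C : Category) (G G' : Functor B C) (F F' : Functor A B)
  (b : NatTrans G G') (a : NatTrans F F') :
  NatTrans (functor_comp G F) (functor_comp G' F').
Proof.
  refine (@Build_NatTrans A C (functor_comp G F) (functor_comp G' F')
            (fun x => b (F' x) ∘ fmap G (a x)) _).
  intros; simpl.
  rewrite cmp_assoc, <- fmap_cmp, (nt_nat a), fmap_cmp, <- cmp_assoc, (nt_nat b).
  apply cmp_assoc.
Defined.

Definition CatBicat : Bicategory.
Proof.
  unshelve refine {|
    bob := Category;
    bhom := FunCat;
    id1 := functor_id;
    cmp1 := functor_comp;
    hcmp := nat_hcomp;
    assoc := fun A B C D H G F =>
      @nat_iso_id A D (functor_comp (functor_comp H G) F)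
        (functor_comp H (functor_comp G F))
        (fun x => idm (H (G (F x)))) (fun x => idm (H (G (F x)))) _ _ _ _;
    lunit := fun A B F =>
      @nat_iso_id A B (functor_comp (functor_id B) F) F
        (fun x => idm (F x)) (fun x => idm (F x)) _ _ _ _;
    runit := fun A B F =>
      @nat_iso_id A B (functor_comp F (functor_id A)) F
        (fun x => idm (F x)) (fun x => idm (F x)) _ _ _ _
  |};
  try (intros; simpl; rewrite ?cmp_idl, ?cmp_idr; reflexivity).
  all: intros; apply nat_trans_eq; intros; simpl;
    rewrite ?fmap_id, ?fmap_cmp, ?fmap_id, ?cmp_idl, ?cmp_idr; try reflexivity.
  - rewrite !cmp_assoc; f_equal.
    rewrite <- !cmp_assoc; f_equal; apply (nt_nat b).
  - rewrite cmp_assoc; reflexivity.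
Defined.

Lemma functor_eq_same (A B : Category) (o : A -> B)
  (m : forall x y : A, hom x y -> hom (o x) (o y)) p q p' q' :
  {| fob := o; fmap := m; fmap_id := p; fmap_cmp := q |} =
  {| fob := o; fmap := m; fmap_id := p'; fmap_cmp := q' |}.
Proof. f_equal; apply proof_irrelevance. Qed.

Lemma eq_hom_nt (A B : Category) (F G : FunCat A B) (e : F = G) (x : A) :
  (eq_hom e : NatTrans F G) x = eq_hom (f_equal (fun H : FunCat A B => fob H x) e).
Proof. destruct e; reflexivity. Qed.

Lemma eq_hom_refl (C : Category) (x : C) (e : x = x) : eq_hom e = idm x.
Proof. rewrite (proof_irrelevance _ e eq_refl); reflexivity. Qed.

Definition CAT : TwoCategory.
Proof.
  refine {| bicat := CatBicat |}.
  - intros A B C D H G F.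
    exists (functor_eq_same _ _ _ _).
    apply nat_trans_eq; intro x; rewrite eq_hom_nt; symmetry; apply eq_hom_refl.
  - intros A B [o m p q].
    exists (functor_eq_same _ _ _ _).
    apply nat_trans_eq; intro x; rewrite eq_hom_nt; symmetry; apply eq_hom_refl.
  - intros A B [o m p q].
    exists (functor_eq_same _ _ _ _).
    apply nat_trans_eq; intro x; rewrite eq_hom_nt; symmetry; apply eq_hom_refl.
Defined.

Definition full_iso (C : Category) (P : C -> Prop) (x y : FullSubcategory P)
  (i : Iso (proj1_sig x) (proj1_sig y)) : Iso x y :=
  @Build_Iso (FullSubcategory P) x y i (iso_bwd i) (iso_bwd_fwd i) (iso_fwd_bwd i).

Lemma full_eq_hom (C : Category) (P : C -> Prop) (x y : FullSubcategory P)
  (s : hom (proj1_sig x) (proj1_sig y)) :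
  (exists e : proj1_sig x = proj1_sig y, s = eq_hom e) ->
  exists e : x = y, (s : hom x y) = eq_hom e.
Proof.
  destruct x as [x p], y as [y q]; simpl in *; intros [e ->].
  destruct e; rewrite (proof_irrelevance _ q p).
  exists eq_refl; reflexivity.
Qed.

Section LocallyFull.
Context (C : TwoCategory) (P : C -> Prop) (Q : forall x y : C, bhom x y -> Prop).
Context (Qid : forall x, Q (id1 x)).
Context (Qcmp : forall x y z (g : bhom y z) (f : bhom x y),
  Q g -> Q f -> Q (g ⊙ f)).

Definition lf_hom (x y : {x : C | P x}) : Category :=
  FullSubcategory (@Q (proj1_sig x) (proj1_sig y)).

Definition lf_id (x : {x : C | P x}) : lf_hom x x :=
  exist _ (id1 (proj1_sig x)) (Qid (proj1_sig x)).

Definition lf_cmp (x y z : {x : C | P x}) (g : lf_hom y z) (f : lf_hom x y) :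
  lf_hom x z :=
  exist _ (proj1_sig g ⊙ proj1_sig f) (Qcmp (proj2_sig g) (proj2_sig f)).

Definition LocallyFullBicat : Bicategory.
Proof.
  refine {|
    bob := {x : C | P x};
    bhom := lf_hom;
    id1 := lf_id;
    cmp1 := lf_cmp;
    hcmp := fun x y z g g' f f' b a => b ⋆ a;
    assoc := fun x y z w h g f =>
      full_iso (x := lf_cmp (lf_cmp h g) f) (y := lf_cmp h (lf_cmp g f))
        (assoc (proj1_sig h) (proj1_sig g) (proj1_sig f));
    lunit := fun x y f =>
      full_iso (x := lf_cmp (lf_id y) f) (y := f) (lunit (proj1_sig f));
    runit := fun x y f =>
      full_iso (x := lf_cmp f (lf_id x)) (y := f) (runit (proj1_sig f)) |}; intros.
  - apply hcmp_id.
  - apply hcmp_cmp.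
  - apply assoc_nat.
  - apply lunit_nat.
  - apply runit_nat.
  - apply triangle.
  - apply pentagon.
Defined.

Definition LocallyFullSub : TwoCategory.
Proof.
  refine {| bicat := LocallyFullBicat |}; intros; apply full_eq_hom.
  - apply strict_assoc.
  - apply strict_lunit.
  - apply strict_runit.
Defined.

End LocallyFull.

Definition FullSubBicat (C : Bicategory) (P : C -> Prop) : Bicategory.
Proof.
  refine {|
    bob := {x : C | P x};
    bhom := fun x y => bhom (proj1_sig x) (proj1_sig y);
    id1 := fun x => id1 (proj1_sig x);
    cmp1 := fun x y z g f => g ⊙ f;
    hcmp := fun x y z g g' f f' b a => b ⋆ a;
    assoc := fun x y z w h g f => assoc h g f;
    lunit := fun x y f => lunit f;
    runit := fun x y f => runit f |}; intros.
  - apply hcmp_id.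
  - apply hcmp_cmp.
  - apply assoc_nat.
  - apply lunit_nat.
  - apply runit_nat.
  - apply triangle.
  - apply pentagon.
Defined.

Definition FullSub (C : TwoCategory) (P : C -> Prop) : TwoCategory.
Proof.
  refine {| bicat := FullSubBicat P |}; intros.
  - apply strict_assoc.
  - apply strict_lunit.
  - apply strict_runit.
Defined.

(** The structure extending an assignment on objects to a pseudofunctor. *)
Record PseudofunctorOn (C D : Bicategory) (F : C -> D) := {
  psf_map :> forall x y : C, Functor (bhom x y) (bhom (F x) (F y));
  psf_cmp : forall x y z (g : bhom y z) (f : bhom x y),
    Iso (psf_map y z g ⊙ psf_map x y f) (psf_map x z (g ⊙ f));
  psf_id : forall x, Iso (id1 (F x)) (psf_map x x (id1 x));
  psf_cmp_nat : forall x y z (g g' : bhom y z) (f f' : bhom x y)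
    (b : hom g g') (a : hom f f'),
    psf_cmp g' f' ∘ (fmap (psf_map y z) b ⋆ fmap (psf_map x y) a) =
    fmap (psf_map x z) (b ⋆ a) ∘ psf_cmp g f;
  psf_assoc : forall x y z w (h : bhom z w) (g : bhom y z) (f : bhom x y),
    fmap (psf_map x w) (assoc h g f) ∘ psf_cmp (h ⊙ g) f ∘
      (psf_cmp h g ⋆ idm (psf_map x y f)) =
    psf_cmp h (g ⊙ f) ∘ (idm (psf_map z w h) ⋆ psf_cmp g f) ∘
      assoc (psf_map z w h) (psf_map y z g) (psf_map x y f);
  psf_lunit : forall x y (f : bhom x y),
    fmap (psf_map x y) (lunit f) ∘ psf_cmp (id1 y) f ∘
      (psf_id y ⋆ idm (psf_map x y f)) = lunit (psf_map x y f);
  psf_runit : forall x y (f : bhom x y),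
    fmap (psf_map x y) (runit f) ∘ psf_cmp f (id1 x) ∘
      (idm (psf_map x y f) ⋆ psf_id x) = runit (psf_map x y f)
}.
Arguments psf_map {_ _ _} _ {_ _}.
Arguments psf_cmp {_ _ _} _ {_ _ _} _ _.
Arguments psf_id {_ _ _} _ _.

Record Pseudofunctor (C D : Bicategory) := {
  psf_ob :> C -> D;
  psf_on : PseudofunctorOn psf_ob
}.

Notation "F # f" := (psf_map (psf_on F) f) (at level 30, right associativity) : cat_scope.
Notation "F ## a" := (fmap (psf_map (psf_on F)) a)
  (at level 30, right associativity) : cat_scope.

Definition iso_refl (C : Category) (x : C) : Iso x x :=
  {| iso_fwd := idm x; iso_bwd := idm x;
     iso_bwd_fwd := cmp_idl (idm x); iso_fwd_bwd := cmp_idl (idm x) |}.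

Definition iso_trans (C : Category) (x y z : C) (j : Iso y z) (i : Iso x y) : Iso x z.
Proof.
  refine {| iso_fwd := j ∘ i; iso_bwd := iso_bwd i ∘ iso_bwd j |}.
  - rewrite cmp_assoc, <- (cmp_assoc (iso_bwd j)), iso_bwd_fwd, cmp_idl.
    apply iso_bwd_fwd.
  - rewrite cmp_assoc, <- (cmp_assoc i), iso_fwd_bwd, cmp_idl.
    apply iso_fwd_bwd.
Defined.

Definition iso_map (C D : Category) (F : Functor C D) (x y : C) (i : Iso x y) :
  Iso (F x) (F y).
Proof.
  refine {| iso_fwd := fmap F i; iso_bwd := fmap F (iso_bwd i) |};
    rewrite <- fmap_cmp, ?iso_bwd_fwd, ?iso_fwd_bwd; apply fmap_id.
Defined.

Lemma cmp_extend (C : Category) (w x y y' z : C) (g : hom y z) (f : hom x y)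
  (g' : hom y' z) (f' : hom x y') (e : g ∘ f = g' ∘ f') (k : hom w x) :
  g ∘ (f ∘ k) = g' ∘ (f' ∘ k).
Proof. rewrite <- !cmp_assoc, e; reflexivity. Qed.

Lemma whisker_r_cmp (C : Bicategory) (x y z : C) (g g' g'' : bhom y z) (f : bhom x y)
  (b' : hom g' g'') (b : hom g g') :
  (b' ∘ b) ⋆ idm f = (b' ⋆ idm f) ∘ (b ⋆ idm f).
Proof. rewrite <- hcmp_cmp, cmp_idl; reflexivity. Qed.

Lemma whisker_l_cmp (C : Bicategory) (x y z : C) (g : bhom y z) (f f' f'' : bhom x y)
  (a' : hom f' f'') (a : hom f f') :
  idm g ⋆ (a' ∘ a) = (idm g ⋆ a') ∘ (idm g ⋆ a).
Proof. rewrite <- hcmp_cmp, cmp_idl; reflexivity. Qed.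

Lemma psf_cmp_nat_r (C D : Bicategory) (F : Pseudofunctor C D) (x y z : C)
  (g g' : bhom y z) (f : bhom x y) (b : hom g g') :
  psf_cmp (psf_on F) g' f ∘ (F ## b ⋆ idm (F # f)) =
  F ## (b ⋆ idm f) ∘ psf_cmp (psf_on F) g f.
Proof. rewrite <- fmap_id; apply psf_cmp_nat. Qed.

Lemma psf_cmp_nat_l (C D : Bicategory) (F : Pseudofunctor C D) (x y z : C)
  (g : bhom y z) (f f' : bhom x y) (a : hom f f') :
  psf_cmp (psf_on F) g f' ∘ (idm (F # g) ⋆ F ## a) =
  F ## (idm g ⋆ a) ∘ psf_cmp (psf_on F) g f.
Proof. rewrite <- fmap_id; apply psf_cmp_nat. Qed.

Definition psf_identity (C : Bicategory) : Pseudofunctor C C.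
Proof.
  refine {| psf_ob := fun x => x;
    psf_on := {|
      psf_map := fun x y => functor_id (bhom x y);
      psf_cmp := fun x y z g f => iso_refl (g ⊙ f);
      psf_id := fun x => iso_refl (id1 x) |} |};
    intros; simpl; rewrite ?hcmp_id, ?cmp_idl, ?cmp_idr; reflexivity.
Defined.

Definition psf_compose (C D E : Bicategory) (G : Pseudofunctor D E)
  (F : Pseudofunctor C D) : Pseudofunctor C E.
Proof.
  refine {| psf_ob := fun x => G (F x);
    psf_on := {|
      psf_map := fun x y => functor_comp (psf_map (psf_on G)) (psf_map (psf_on F));
      psf_cmp := fun x y z g f =>
        iso_trans (iso_map (psf_map (psf_on G)) (psf_cmp (psf_on F) g f))
          (psf_cmp (psf_on G) (F # g) (F # f));
      psf_id := fun x =>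
        iso_trans (iso_map (psf_map (psf_on G)) (psf_id (psf_on F) x))
          (psf_id (psf_on G) (F x)) |} |}.
  - intros; cbn [iso_fwd iso_trans iso_map functor_comp fmap fob].
    rewrite cmp_assoc, psf_cmp_nat, <- cmp_assoc, <- fmap_cmp, psf_cmp_nat, fmap_cmp.
    apply cmp_assoc.
  - intros; cbn [iso_fwd iso_trans iso_map functor_comp fmap fob].
    rewrite whisker_r_cmp, whisker_l_cmp, !cmp_assoc.
    rewrite (cmp_extend (psf_cmp_nat_r G _ (iso_fwd (psf_cmp (psf_on F) h g)))).
    do 2 rewrite <- (cmp_assoc (G ## _) (G ## _)), <- fmap_cmp.
    rewrite psf_assoc, 2!fmap_cmp, !cmp_assoc.
    rewrite (cmp_extend (psf_cmp_nat_l G _ (iso_fwd (psf_cmp (psf_on F) g f)))).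
    do 2 f_equal.
    rewrite <- !cmp_assoc; apply (psf_assoc (psf_on G)).
  - intros; cbn [iso_fwd iso_trans iso_map functor_comp fmap fob].
    rewrite whisker_r_cmp, !cmp_assoc.
    rewrite (cmp_extend (psf_cmp_nat_r G _ (iso_fwd (psf_id (psf_on F) y)))).
    rewrite <- (psf_lunit (psf_on G)), <- (psf_lunit (psf_on F)), !fmap_cmp, !cmp_assoc.
    reflexivity.
  - intros; cbn [iso_fwd iso_trans iso_map functor_comp fmap fob].
    rewrite whisker_l_cmp, !cmp_assoc.
    rewrite (cmp_extend (psf_cmp_nat_l G _ (iso_fwd (psf_id (psf_on F) x)))).
    rewrite <- (psf_runit (psf_on G)), <- (psf_runit (psf_on F)), !fmap_cmp, !cmp_assoc.
    reflexivity.
Defined.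

(** [pst_nat f] is the 2-cell [G f ⊙ pst x => pst y ⊙ F f]; the last two axioms
    are its compatibility with the constraint cells of [F] and [G]. *)
Record PseudoNat (C D : Bicategory) (F G : Pseudofunctor C D) := {
  pst :> forall x : C, bhom (F x) (G x);
  pst_nat : forall (x y : C) (f : bhom x y), Iso (G # f ⊙ pst x) (pst y ⊙ F # f);
  pst_nat_nat : forall (x y : C) (f f' : bhom x y) (a : hom f f'),
    pst_nat f' ∘ (G ## a ⋆ idm (pst x)) = (idm (pst y) ⋆ F ## a) ∘ pst_nat f;
  pst_id : forall x : C,
    pst_nat (id1 x) ∘ (psf_id (psf_on G) x ⋆ idm (pst x)) =
    (idm (pst x) ⋆ psf_id (psf_on F) x) ∘ iso_bwd (runit (pst x)) ∘ lunit (pst x);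
  pst_cmp : forall (x y z : C) (g : bhom y z) (f : bhom x y),
    pst_nat (g ⊙ f) ∘ (psf_cmp (psf_on G) g f ⋆ idm (pst x)) =
    (idm (pst z) ⋆ psf_cmp (psf_on F) g f) ∘ assoc (pst z) (F # g) (F # f) ∘
      (pst_nat g ⋆ idm (F # f)) ∘ iso_bwd (assoc (G # g) (pst y) (F # f)) ∘
      (idm (G # g) ⋆ pst_nat f) ∘ assoc (G # g) (G # f) (pst x)
}.

Section Biadjunction.
Context (C D : Bicategory) (L : Pseudofunctor C D) (R : Pseudofunctor D C).
Context (eta : PseudoNat (psf_identity C) (psf_compose R L)).

Definition transpose (x : C) (y : D) : Functor (bhom (L x) y) (bhom x (R y)).
Proof.
  refine (@Build_Functor (bhom (L x) y) (bhom x (R y))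
            (fun g => R # g ⊙ eta x)
            (fun g g' b => R ## b ⋆ idm (eta x)) _ _).
  - intro g; rewrite fmap_id; apply hcmp_id.
  - intros g g' g'' b b'; rewrite fmap_cmp, <- hcmp_cmp, cmp_idl; reflexivity.
Defined.

(** The functors [D(L x, y) -> C(x, R y)], [g |-> R g ⊙ eta x], are pseudonatural
    in [x] and [y] because [eta] is pseudonatural. [L] is left biadjoint to [R] with
    unit [eta] when they are equivalences; [eta x] is the transpose of [id1 (L x)],
    up to the unit constraints of [R] and [C]. *)
Definition IsBiadjunctionUnit : Prop :=
  forall (x : C) (y : D), IsEquivalence (transpose x y).

End Biadjunction.

Definition full_inclusion (C : TwoCategory) (P : C -> Prop) :
  Pseudofunctor (@FullSub C P) C.
Proof.
  refine (@Build_Pseudofunctor (@FullSub C P) C (fun x => proj1_sig x)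
    (@Build_PseudofunctorOn (@FullSub C P) C (fun x => proj1_sig x)
      (fun x y => functor_id (@bhom C (proj1_sig x) (proj1_sig y)))
      (fun x y z g f => iso_refl (@cmp1 C _ _ _ g f))
      (fun x => iso_refl (@id1 C (proj1_sig x))) _ _ _ _));
    intros; simpl; rewrite ?hcmp_id, ?cmp_idl, ?cmp_idr; reflexivity.
Defined.

Definition Lex0 : TwoCategory :=
  @LocallyFullSub CAT (fun A : Category => FinitelyComplete A /\ HasInitial A)
    LeftExact left_exact_id left_exact_comp.

Definition lex0_cat (A : Lex0) : Category := proj1_sig A.

Definition lex0_functor (A B : Lex0) (F : bhom A B) :
  Functor (lex0_cat A) (lex0_cat B) := proj1_sig F.

Definition LexStar : TwoCategory :=
  @FullSub Lex0 (fun A : Lex0 => Pointed (lex0_cat A)).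

Definition LexStar_incl : Pseudofunctor LexStar Lex0 := @full_inclusion Lex0 _.

Definition lexstar_ob (K : Lex0 -> Category)
  (HK : forall A, FinitelyComplete (K A) /\ HasInitial (K A))
  (HP : forall A, Pointed (K A)) (A : Lex0) : LexStar :=
  exist _ (exist _ (K A) (HK A)) (HP A).

(* Main.v *)
(** Let [u_X : X -> p^* (dom X)] be the unit of the adjunction [dom -| p^*] between
    [A/0] and [A]. For [x : X -> 0] its naturality square at [X -> 1] is a pullback
    in [A/0], exhibiting [X] as the pullback of [p^* x] along a point [1 -> p^* 0].
    A left-exact functor [F] from [A/0] to a pointed category therefore makes [F X]
    the kernel of [F p^* x], so [F] and the transformations between such functors are
    determined by their restrictions along [p^*]. Conversely a left-exact [H : A -> Y]
    extends by sending [x] to the pullback of [H x] along [0 -> H 0], and on [p^* a]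
    this is the kernel of the product projection [H 0 x H a -> H 0], that is, [H a].
    So precomposition with [p^*] is an equivalence; hence each [p^*] is a universal
    arrow to [Lex_*], and the pseudofunctor, its constraint cells and the
    pseudonaturality of [p^*] are the unique lifts along these equivalences. *)

Require Import Defs.
From Stdlib Require Import FinFun List ProofIrrelevance IndefiniteDescription.

Set Implicit Arguments.
Unset Strict Implicit.
Unset Printing Implicit Defensive.

(** * Terminal, initial and zero objects *)

Lemma terminal_eq (C : Category) (x y : C) (f g : hom x y) : IsTerminal y -> f = g.
Proof. intros H; destruct (H x) as [t [_ Ht]]; rewrite <- (Ht f), <- (Ht g); auto. Qed.

Lemma initial_eq (C : Category) (x y : C) (f g : hom x y) : IsInitial x -> f = g.
Proof. intros H; destruct (H y) as [t [_ Ht]]; rewrite <- (Ht f), <- (Ht g); auto. Qed.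

Lemma terminal_iso (C : Category) (x y : C) : Iso x y -> IsTerminal x -> IsTerminal y.
Proof.
  intros i H w; destruct (H w) as [f _].
  exists (i ∘ f); split; [exact I|]; intros g _.
  rewrite (terminal_eq f (iso_bwd i ∘ g) H), <- cmp_assoc, iso_fwd_bwd; apply cmp_idl.
Qed.

Lemma initial_iso (C : Category) (x y : C) : Iso x y -> IsInitial x -> IsInitial y.
Proof.
  intros i H w; destruct (H w) as [f _].
  exists (f ∘ iso_bwd i); split; [exact I|]; intros g _.
  rewrite (initial_eq f (g ∘ i) H), cmp_assoc, iso_fwd_bwd; apply cmp_idr.
Qed.

Lemma iso_terminal (C : Category) (x y : C) :
  IsTerminal x -> IsTerminal y -> inhabited (Iso x y).
Proof.
  intros Hx Hy; destruct (Hy x) as [f _], (Hx y) as [g _].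
  constructor; refine {| iso_fwd := f; iso_bwd := g |}; apply terminal_eq; assumption.
Qed.

Lemma iso_initial (C : Category) (x y : C) :
  IsInitial x -> IsInitial y -> inhabited (Iso x y).
Proof.
  intros Hx Hy; destruct (Hx y) as [f _], (Hy x) as [g _].
  constructor; refine {| iso_fwd := f; iso_bwd := g |}; apply initial_eq; assumption.
Qed.

(** Initial objects are unique up to isomorphism, so each one is a zero object of a pointed
    category. *)
Lemma pointed_zero_terminal (C : Category) (x : C) :
  Pointed C -> IsInitial x -> IsTerminal x.
Proof.
  intros [z [Hi Ht]] Hx; destruct (iso_initial Hi Hx) as [i].
  exact (terminal_iso i Ht).
Qed.

Lemma pointed_one_initial (C : Category) (x : C) :
  Pointed C -> IsTerminal x -> IsInitial x.
Proof.
  intros [z [Hi Ht]] Hx; destruct (iso_terminal Ht Hx) as [i].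
  exact (initial_iso i Hi).
Qed.

(** * Limits in slices *)

Definition right_cone_hom (J : Category) (i j : option J) : Type :=
  match i, j with
  | Some i, Some j => hom i j
  | _, None => unit
  | None, Some _ => Empty_set
  end.

(* [J] with a new terminal object [None]. *)
Definition RightCone (J : Category) : Category.
Proof.
  unshelve refine {|
    ob := option J;
    hom := @right_cone_hom J |}.
  - intros [i|]; [exact (idm i) | exact tt].
  - intros [i|] [j|] [k|] g f; simpl in *; try contradiction; try exact tt.
    exact (g ∘ f).
  - intros [i|] [j|] f; simpl in *; try contradiction;
      [apply cmp_idl | destruct f; reflexivity | destruct f; reflexivity].
  - intros [i|] [j|] f; simpl in *; try contradiction;
      [apply cmp_idr | destruct f; reflexivity | destruct f; reflexivity].
  - intros [i|] [j|] [k|] [l|] h g f; simpl in *; try contradiction; try reflexivity.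
    apply cmp_assoc.
Defined.

Lemma right_cone_finite (J : Category) : FiniteCategory J -> FiniteCategory (RightCone J).
Proof.
  intros [[l Hl] Hh]; split.
  - exists (None :: map Some l); intros [j|]; [right|left; reflexivity].
    apply in_map, Hl.
  - intros [i|] [j|]; simpl.
    + apply Hh.
    + exists (tt :: nil); intros []; left; reflexivity.
    + exists nil; intros [].
    + exists (tt :: nil); intros []; left; reflexivity.
Qed.

Section SliceLimits.
Context (A : Category) (x : A) (J : Category) (D : Functor J (Slice x)).

(** The structure maps to [x] become the images of the arrows into [None]. Cones over [D] and over
    this diagram correspond, so limits in the slice are computed in [A]. *)
Definition slice_diagram : Functor (RightCone J) A.
Proof.
  unshelve refine (@Build_Functor (RightCone J) A
    (fun j => match j with Some j => slice_dom (D j) | None => x end) _ _ _).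
  - intros [i|] [j|] f; simpl in *; try contradiction.
    + exact (slice_hom (fmap D f)).
    + exact (slice_map (D i)).
    + exact (idm x).
  - intros [i|]; simpl; [rewrite fmap_id|]; reflexivity.
  - intros [i|] [j|] [k|] g f; simpl in *; try contradiction.
    + rewrite fmap_cmp; reflexivity.
    + symmetry; apply slice_hom_comm.
    + symmetry; apply cmp_idl.
    + symmetry; apply cmp_idl.
Defined.

Definition slice_diagram_cone (c : Cone D) : Cone slice_diagram.
Proof.
  refine (@Build_Cone _ _ slice_diagram (slice_dom (apex c))
    (fun j => match j return hom _ (slice_diagram j) with
              | Some j => slice_hom (leg c j) : hom _ (slice_dom (D j))
              | None => slice_map (apex c) end) _).
  intros [i|] [j|] f; simpl in *; try contradiction.
  - exact (f_equal (@slice_hom _ _ _ _) (leg_nat c f)).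
  - apply slice_hom_comm.
  - apply cmp_idl.
Defined.

Definition cone_of_slice_diagram (c : Cone slice_diagram) : Cone D.
Proof.
  refine (@Build_Cone _ _ D (Build_SliceOb (leg c None))
    (fun j => @Build_SliceHom A x (Build_SliceOb (leg c None)) (D j) (leg c (Some j))
                (@leg_nat _ _ _ c (Some j) None tt)) _).
  intros i j f; apply slice_hom_eq; exact (@leg_nat _ _ _ c (Some i) (Some j) f).
Defined.

Lemma slice_limit (c : Cone slice_diagram) :
  IsLimit c -> IsLimit (cone_of_slice_diagram c).
Proof.
  intros Hc c'; destruct (Hc (slice_diagram_cone c')) as [u [Hu Uu]].
  exists (@Build_SliceHom A x (apex c') (Build_SliceOb (leg c None)) u (Hu None)).
  split.
  - intro j; apply slice_hom_eq; exact (Hu (Some j)).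
  - intros v Hv; apply slice_hom_eq, Uu; intros [j|].
    + exact (f_equal (@slice_hom _ _ _ _) (Hv j)).
    + exact (slice_hom_comm v).
Qed.

(** This direction turns a limit in the slice into one in [A], to which a left-exact functor on [A]
    can be applied. *)
Lemma limit_slice_diagram (c : Cone D) : IsLimit c -> IsLimit (slice_diagram_cone c).
Proof.
  intros Hc c'; destruct (Hc (cone_of_slice_diagram c')) as [u [Hu Uu]].
  exists (slice_hom u); split.
  - intros [j|].
    + exact (f_equal (@slice_hom _ _ _ _) (Hu j)).
    + exact (slice_hom_comm u).
  - intros v Hv.
    refine (f_equal (@slice_hom _ _ _ _)
      (Uu (@Build_SliceHom A x (Build_SliceOb (leg c' None)) (apex c) v (Hv None)) _)).
    intro j; apply slice_hom_eq; exact (Hv (Some j)).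
Qed.

End SliceLimits.

Lemma slice_finitely_complete (A : Category) (x : A) :
  FinitelyComplete A -> FinitelyComplete (Slice x).
Proof.
  intros HA J HJ D.
  destruct (HA _ (right_cone_finite HJ) (slice_diagram D)) as [c Hc].
  exists (cone_of_slice_diagram c); apply slice_limit, Hc.
Qed.

Definition slice_one (A : Category) (x : A) : Slice x := Build_SliceOb (idm x).

Definition slice_bang (A : Category) (x : A) (s : Slice x) : hom s (slice_one x) :=
  @Build_SliceHom A x s (slice_one x) (slice_map s) (cmp_idl (slice_map s)).

Lemma slice_one_terminal (A : Category) (x : A) : IsTerminal (slice_one x).
Proof.
  intro s; exists (slice_bang s); split; [exact I|].
  intros [f Hf] _; apply slice_hom_eq; simpl in *.
  rewrite <- Hf; apply cmp_idl.
Qed.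

(** A map out of [slice_one x] is a map out of [x] in [A], and its triangle commutes because [x] is
    initial. The terminal object of the slice is thus a zero object. *)
Lemma slice_one_initial (A : Category) (x : A) : IsInitial x -> IsInitial (slice_one x).
Proof.
  intros Hx s; destruct (Hx (slice_dom s)) as [f Hf].
  unshelve eexists (@Build_SliceHom A x (slice_one x) s f _).
  - apply initial_eq, Hx.
  - split; [exact I|]; intros g _; apply slice_hom_eq, initial_eq, Hx.
Qed.

Lemma slice_initial_pointed (A : Category) (x : A) : IsInitial x -> Pointed (Slice x).
Proof.
  intro Hx; exists (slice_one x); split;
    [apply slice_one_initial, Hx | apply slice_one_terminal].
Qed.

(** * Left-exact functors *)

Definition Discrete (T : Type) : Category.
Proof.
  refine {| ob := T; hom := fun i j => i = j; idm := @eq_refl T;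
            cmp := fun i j k g f => eq_trans f g |};
    intros; apply proof_irrelevance.
Defined.

Definition discrete_diagram (T : Type) (C : Category) (D : T -> C) :
  Functor (Discrete T) C.
Proof.
  refine (@Build_Functor (Discrete T) C D
    (fun i j e => match e in _ = j return hom (D i) (D j) with eq_refl => idm _ end) _ _).
  - reflexivity.
  - intros i j k [] []; symmetry; apply cmp_idl.
Defined.

Definition discrete_cone (T : Type) (C : Category) (D : T -> C) (x : C)
  (l : forall i, hom x (D i)) : Cone (discrete_diagram D).
Proof.
  refine (@Build_Cone _ _ (discrete_diagram D) x l _).
  intros i j []; apply cmp_idl.
Defined.

Lemma discrete_finite (T : Type) :
  (forall i j : T, {i = j} + {i <> j}) -> Finite T -> FiniteCategory (Discrete T).
Proof.
  intros Hd HT; split; [exact HT|]; intros i j; simpl.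
  destruct (Hd i j) as [e|n].
  - exists (e :: nil); intro e'; left; apply proof_irrelevance.
  - exists nil; intro e; contradiction.
Qed.

(** A terminal object is a limit of the empty diagram. *)
Lemma lex_terminal (A B : Category) (F : Functor A B) (x : A) :
  LeftExact F -> IsTerminal x -> IsTerminal (F x).
Proof.
  intros HF Hx.
  assert (HJ : FiniteCategory (Discrete Empty_set)).
  { apply discrete_finite; [intros []|]; exists nil; intros []. }
  pose (c := @discrete_cone Empty_set A (fun i => match i with end) x
               (fun i => match i with end)).
  assert (Hc : IsLimit c).
  { intro c'; destruct (Hx (apex c')) as [u Hu].
    exists u; split; [intros []|]; intros v _; apply Hu, I. }
  intro w.
  destruct (HF _ HJ _ c Hc
    (@Build_Cone (Discrete Empty_set) B _ w (fun i => match i with end)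
       (fun i => match i with end))) as [u [_ Uu]].
  exists u; split; [exact I|]; intros v _; apply Uu; intros [].
Qed.

Section LexPullback.
Context (A B : Category) (F : Functor A B) (HF : LeftExact F).
Context (x y z : A) (f : hom x z) (g : hom y z) (p : Pullback f g).

Lemma lex_pullback_comm : fmap F f ∘ fmap F (pb1 p) = fmap F g ∘ fmap F (pb2 p).
Proof. rewrite <- !fmap_cmp, pb_comm; reflexivity. Qed.

(** A pullback over [z] is a binary product in the slice over [z]. By [limit_slice_diagram] it is
    also a limit in [A] of a cospan, the shape [RightCone (Discrete bool)], and [F] preserves that
    limit. *)
Lemma lex_pullback_univ (w : B) (h : hom w (F x)) (k : hom w (F y)) :
  fmap F f ∘ h = fmap F g ∘ k ->
  exists! u : hom w (F p), fmap F (pb1 p) ∘ u = h /\ fmap F (pb2 p) ∘ u = k.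
Proof.
  intro e.
  pose (D := discrete_diagram (C := Slice z)
    (fun b : bool => if b then Build_SliceOb f else Build_SliceOb g)).
  pose (P := @Build_SliceOb A z p (f ∘ pb1 p) : Slice z).
  pose (c := @discrete_cone bool (Slice z)
    (fun b : bool => if b then Build_SliceOb f else Build_SliceOb g) P
    (fun b => match b return
         @hom (Slice z) P (if b then Build_SliceOb f else Build_SliceOb g) with
     | true => @Build_SliceHom A z P (Build_SliceOb f) (pb1 p) eq_refl
     | false => @Build_SliceHom A z P (Build_SliceOb g) (pb2 p) (eq_sym (pb_comm p))
     end) : Cone D).
  assert (Hc : IsLimit c).
  { intro c'.
    pose (l1 := leg c' true : SliceHom (apex c') (Build_SliceOb f)).
    pose (l2 := leg c' false : SliceHom (apex c') (Build_SliceOb g)).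
    destruct (@pb_univ _ _ _ _ _ _ p _ (slice_hom l1) (slice_hom l2)) as [u [[H1 H2] Uu]].
    { etransitivity; [apply (slice_hom_comm l1)|]; symmetry; apply (slice_hom_comm l2). }
    unshelve eexists (@Build_SliceHom A z (apex c') P u _).
    { simpl; rewrite cmp_assoc, H1; apply (slice_hom_comm l1). }
    split.
    - intros []; apply slice_hom_eq; [exact H1 | exact H2].
    - intros v Hv; apply slice_hom_eq, Uu; split.
      + exact (f_equal (@slice_hom _ _ _ _) (Hv true)).
      + exact (f_equal (@slice_hom _ _ _ _) (Hv false)). }
  assert (HJ : FiniteCategory (Discrete bool)).
  { apply discrete_finite; [exact Bool.bool_dec|].
    exists (true :: false :: nil); intros []; simpl; auto. }
  (* The maps [h] and [k] form a cone on the image of the cospan; the leg at [None], the vertex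
     [F z], is forced. *)
  pose (l := fun j : RightCone (Discrete bool) =>
    match j return hom w (F (slice_diagram D j)) with
    | Some true => h | Some false => k | None => fmap F f ∘ h end).
  assert (Hl : forall i j (q : hom i j),
    fmap (functor_comp F (slice_diagram D)) q ∘ l i = l j).
  { intros [[]|] [[]|] q; try discriminate q; try contradiction q; simpl.
    - rewrite (proof_irrelevance (true = true) q eq_refl), fmap_id; apply cmp_idl.
    - reflexivity.
    - rewrite (proof_irrelevance (false = false) q eq_refl), fmap_id; apply cmp_idl.
    - symmetry; exact e.
    - rewrite fmap_id; apply cmp_idl. }
  destruct (HF (right_cone_finite HJ) (limit_slice_diagram Hc) (Build_Cone Hl))
    as [u [Hu Uu]].
  exists u; split.
  - split; [exact (Hu (Some true)) | exact (Hu (Some false))].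
  - intros v [H1 H2]; apply Uu; intros [[]|]; simpl; [exact H1 | exact H2 |].
    rewrite fmap_cmp, cmp_assoc, H1; reflexivity.
Qed.

Definition lex_pullback : Pullback (fmap F f) (fmap F g) :=
  {| pb_comm := lex_pullback_comm; pb_univ := lex_pullback_univ |}.

End LexPullback.

Lemma terminal_product (C : Category) (x y z w : C) (f : hom x z) (g : hom y z)
  (p : Pullback f g) (h : hom w x) (k : hom w y) :
  IsTerminal z -> exists u : hom w p, pb1 p ∘ u = h /\ pb2 p ∘ u = k.
Proof.
  intro Hz; destruct (pb_univ p (terminal_eq (f ∘ h) (g ∘ k) Hz)) as [u [Hu _]].
  exists u; exact Hu.
Qed.

Definition slice_functor (A B : Category) (F : Functor A B) (x : A) :
  Functor (Slice x) (Slice (F x)).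
Proof.
  unshelve refine (@Build_Functor (Slice x) (Slice (F x))
    (fun s => Build_SliceOb (fmap F (slice_map s)))
    (fun s t h => @Build_SliceHom B (F x) (Build_SliceOb (fmap F (slice_map s)))
       (Build_SliceOb (fmap F (slice_map t))) (fmap F (slice_hom h)) _) _ _).
  - simpl; rewrite <- fmap_cmp, slice_hom_comm; reflexivity.
  - intros; apply slice_hom_eq, fmap_id.
  - intros; apply slice_hom_eq, fmap_cmp.
Defined.

Definition slice_forget (A : Category) (x : A) : Functor (Slice x) A.
Proof.
  refine (@Build_Functor (Slice x) A (@slice_dom A x) (fun s t h => slice_hom h) _ _);
    reflexivity.
Defined.

(** * The functor [p^*] *)

Section Pstar.
Context (A : Category) (ch : Chosen A).

(** The product projection from [0 x a] to [a]: the counit of the adjunction between the forgetful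
    functor and [pstar]. *)
Definition pstar_snd (a : A) : hom (slice_dom (pstar ch a)) a :=
  pb2 (pullback ch (the (zero_initial ch (one ch))) (slice_map (to_slice_one ch a))).

Lemma pstar_snd_nat (a b : A) (f : hom a b) :
  pstar_snd b ∘ slice_hom (fmap (pstar ch) f) = f ∘ pstar_snd a.
Proof.
  exact (pullback_hom_pb2 ch (the (zero_initial ch (one ch))) (fmap (to_slice_one ch) f)).
Qed.

Lemma pstar_snd_cmp (a b : A) (f : hom a b) (s : Slice (zero ch))
  (u : hom s (pstar ch a)) :
  pstar_snd b ∘ slice_hom (fmap (pstar ch) f ∘ u) = f ∘ (pstar_snd a ∘ slice_hom u).
Proof.
  change (slice_hom (fmap (pstar ch) f ∘ u))
    with (slice_hom (fmap (pstar ch) f) ∘ slice_hom u).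
  rewrite <- !cmp_assoc, pstar_snd_nat; reflexivity.
Qed.

(** The component into [0] has to be the structure map of [s], so only the component into [a] is
    free. Together with [pstar_hom_eq] this is the hom-set bijection of the adjunction. *)
Lemma pstar_transpose (s : Slice (zero ch)) (a : A) (f : hom (slice_dom s) a) :
  exists u : hom s (pstar ch a), pstar_snd a ∘ slice_hom u = f.
Proof.
  destruct (@terminal_product A _ _ _ _ _ _
    (pullback ch (the (zero_initial ch (one ch))) (slice_map (to_slice_one ch a)))
    (slice_map s) f (one_terminal ch)) as [u [H1 H2]].
  exists (@Build_SliceHom A _ s (pstar ch a) u H1); exact H2.
Qed.

Lemma pstar_hom_eq (s : Slice (zero ch)) (a : A) (u v : hom s (pstar ch a)) :
  pstar_snd a ∘ slice_hom u = pstar_snd a ∘ slice_hom v -> u = v.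
Proof.
  intro H; apply slice_hom_eq, pb_uniq; [|exact H].
  etransitivity; [apply (slice_hom_comm u)|]; symmetry; apply (slice_hom_comm v).
Qed.

(** A right adjoint preserves limits: a cone on the image of [D] is transposed to a cone on [D],
    factored there, and the factorization is transposed back. *)
Lemma pstar_lex : LeftExact (pstar ch).
Proof.
  intros J HJ D c Hc c'.
  assert (Hl : forall i j (f : hom i j),
    fmap D f ∘ (pstar_snd (D i) ∘ slice_hom (leg c' i)) =
    pstar_snd (D j) ∘ slice_hom (leg c' j)).
  { intros i j f; rewrite <- cmp_assoc, <- pstar_snd_nat, cmp_assoc.
    f_equal; exact (f_equal (@slice_hom _ _ _ _) (leg_nat c' f)). }
  destruct (Hc (Build_Cone Hl)) as [u [Hu Uu]].
  destruct (@pstar_transpose (apex c') (apex c) u) as [v Hv].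
  exists v; split.
  - intro j; apply pstar_hom_eq.
    etransitivity; [apply pstar_snd_cmp|]; rewrite Hv; apply Hu.
  - intros v' Hv'; apply pstar_hom_eq; rewrite Hv; apply Uu; intro j; simpl leg.
    rewrite <- (Hv' j); symmetry; apply pstar_snd_cmp.
Qed.

Lemma slice_unit_ex (s : Slice (zero ch)) :
  exists u : hom s (pstar ch (slice_dom s)),
    pstar_snd (slice_dom s) ∘ slice_hom u = idm (slice_dom s).
Proof. apply pstar_transpose. Qed.

(* The unit of the adjunction between the forgetful functor and [pstar]. *)
Definition slice_unit (s : Slice (zero ch)) : hom s (pstar ch (slice_dom s)) :=
  proj1_sig (constructive_indefinite_description _ (slice_unit_ex s)).

Lemma slice_unit_snd (s : Slice (zero ch)) :
  pstar_snd (slice_dom s) ∘ slice_hom (slice_unit s) = idm (slice_dom s).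
Proof. exact (proj2_sig (constructive_indefinite_description _ (slice_unit_ex s))). Qed.

Lemma slice_unit_nat (s t : Slice (zero ch)) (h : hom s t) :
  fmap (pstar ch) (slice_hom h) ∘ slice_unit s = slice_unit t ∘ h.
Proof.
  apply pstar_hom_eq; rewrite pstar_snd_cmp, slice_unit_snd, cmp_idr.
  simpl slice_hom; rewrite <- cmp_assoc, slice_unit_snd; symmetry; apply cmp_idl.
Qed.

(** A triangle identity of the adjunction. *)
Lemma pstar_snd_unit (a : A) :
  fmap (pstar ch) (pstar_snd a) ∘ slice_unit (pstar ch a) = idm (pstar ch a).
Proof.
  apply pstar_hom_eq; rewrite pstar_snd_cmp, slice_unit_snd; reflexivity.
Qed.

Lemma slice_unit_map (s : Slice (zero ch)) :
  fmap (pstar ch) (slice_map s) ∘ slice_unit s =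
  slice_unit (slice_one (zero ch)) ∘ slice_bang s.
Proof. exact (slice_unit_nat (slice_bang s)). Qed.

(* An object [x : X -> 0] of the slice is the pullback of [p^* x] along a point
   of [p^* 0]. *)
Definition slice_unit_pullback (s : Slice (zero ch)) :
  Pullback (fmap (pstar ch) (slice_map s)) (slice_unit (slice_one (zero ch))).
Proof.
  refine (@Build_Pullback _ _ _ _ (fmap (pstar ch) (slice_map s))
    (slice_unit (slice_one (zero ch))) s (slice_unit s) (slice_bang s) (slice_unit_map s) _).
  intros w h k e.
  (* The transpose of [h] underlies the required map to [s]; [e] makes it a map over [zero ch]. *)
  pose (g := pstar_snd (slice_dom s) ∘ slice_hom h).
  assert (Hg : slice_map s ∘ g = slice_map w).
  { unfold g; rewrite <- pstar_snd_cmp, e; simpl slice_hom.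
    rewrite <- cmp_assoc.
    etransitivity; [apply (f_equal (fun m => m ∘ slice_hom k)), slice_unit_snd|].
    exact (slice_hom_comm k). }
  exists (@Build_SliceHom A _ w s g Hg); split; [split|].
  - apply pstar_hom_eq; simpl slice_hom.
    rewrite <- cmp_assoc, slice_unit_snd; apply cmp_idl.
  - apply terminal_eq, slice_one_terminal.
  - intros v [Hv _]; apply slice_hom_eq; simpl slice_hom; unfold g.
    rewrite <- Hv; simpl slice_hom.
    rewrite <- cmp_assoc, slice_unit_snd; apply cmp_idl.
Defined.

End Pstar.

(** * Restriction along [p^*] is fully faithful *)

Lemma zero_cmp_eq (C : Category) (x o y : C) (g g' : hom o y) (f f' : hom x o) :
  IsInitial o -> IsTerminal o -> g ∘ f = g' ∘ f'.
Proof.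
  intros Hi Ht; rewrite (initial_eq g g' Hi), (terminal_eq f f' Ht); reflexivity.
Qed.

Section PstarFullyFaithful.
Context (A : Category) (ch : Chosen A) (Y : Category) (HY : Pointed Y).
Context (F G : Functor (Slice (zero ch)) Y) (HF : LeftExact F) (HG : LeftExact G).
Context (s : forall a, hom (F (pstar ch a)) (G (pstar ch a))).
Context (s_nat : forall a b (f : hom a b),
  s b ∘ fmap F (fmap (pstar ch) f) = fmap G (fmap (pstar ch) f) ∘ s a).

Let F_pt_terminal : IsTerminal (F (slice_one (zero ch))).
Proof. apply lex_terminal; [exact HF | apply slice_one_terminal]. Qed.

Let F_pt_initial : IsInitial (F (slice_one (zero ch))).
Proof. exact (pointed_one_initial HY F_pt_terminal). Qed.

Let G_pt_terminal : IsTerminal (G (slice_one (zero ch))).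
Proof. apply lex_terminal; [exact HG | apply slice_one_terminal]. Qed.

(** [G] preserves the pullback [slice_unit_pullback], so the image of the unit is a pullback of a
    map out of a terminal object, hence monic. *)
Lemma slice_unit_image_mono (x : Slice (zero ch)) (w : Y) (u v : hom w (G x)) :
  fmap G (slice_unit x) ∘ u = fmap G (slice_unit x) ∘ v -> u = v.
Proof.
  intro H; apply (pb_uniq (p := lex_pullback HG (slice_unit_pullback x))); [exact H|].
  apply terminal_eq, G_pt_terminal.
Qed.

(** The component at [x] is induced by the pullback that presents [G x]. *)
Lemma pstar_extension_ex (x : Slice (zero ch)) :
  exists t : hom (F x) (G x),
    fmap G (slice_unit x) ∘ t = s (slice_dom x) ∘ fmap F (slice_unit x).
Proof.
  destruct (G_pt_terminal (F (slice_one (zero ch)))) as [b _].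
  destruct (pb_univ (lex_pullback HG (slice_unit_pullback x))
    (h := s (slice_dom x) ∘ fmap F (slice_unit x))
    (k := b ∘ fmap F (slice_bang x))) as [t [[Ht _] _]].
  - rewrite <- cmp_assoc, <- (s_nat (slice_map x)), cmp_assoc; simpl.
    rewrite <- fmap_cmp, slice_unit_map, fmap_cmp, <- !cmp_assoc.
    (* By naturality of [s] and of the unit, both sides factor through [F (slice_one (zero ch))], a
       zero object of [Y]. *)
    apply zero_cmp_eq; assumption.
  - exists t; exact Ht.
Qed.

Definition pstar_extension (x : Slice (zero ch)) : hom (F x) (G x) :=
  proj1_sig (constructive_indefinite_description _ (pstar_extension_ex x)).

Lemma pstar_extension_unit (x : Slice (zero ch)) :
  fmap G (slice_unit x) ∘ pstar_extension x = s (slice_dom x) ∘ fmap F (slice_unit x).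
Proof. exact (proj2_sig (constructive_indefinite_description _ (pstar_extension_ex x))). Qed.

(** After composition with the monic [fmap G (slice_unit y)] this follows from naturality of the
    unit and of [s]. *)
Lemma pstar_extension_nat (x y : Slice (zero ch)) (h : hom x y) :
  pstar_extension y ∘ fmap F h = fmap G h ∘ pstar_extension x.
Proof.
  apply slice_unit_image_mono.
  rewrite <- !cmp_assoc, pstar_extension_unit, <- fmap_cmp, <- slice_unit_nat, fmap_cmp.
  rewrite (cmp_assoc (fmap G _)), pstar_extension_unit, cmp_assoc, <- fmap_cmp.
  rewrite <- slice_unit_nat, fmap_cmp, <- !cmp_assoc.
  f_equal; exact (s_nat (slice_hom h)).
Qed.

(** The composite of [G] with [p^*] is left exact, so it preserves the product [0 x a] underlying
    [p^* a]. *)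
Lemma pstar_pstar_jointly_mono (a : A) (w : Y)
  (u v : hom w (G (pstar ch (slice_dom (pstar ch a))))) :
  fmap G (fmap (pstar ch) (slice_map (pstar ch a))) ∘ u =
    fmap G (fmap (pstar ch) (slice_map (pstar ch a))) ∘ v ->
  fmap G (fmap (pstar ch) (pstar_snd ch a)) ∘ u =
    fmap G (fmap (pstar ch) (pstar_snd ch a)) ∘ v -> u = v.
Proof.
  intros H1 H2.
  exact (pb_uniq (p := lex_pullback (left_exact_comp HG (@pstar_lex A ch))
    (pullback ch (the (zero_initial ch (one ch))) (slice_map (to_slice_one ch a)))) H1 H2).
Qed.

(* [p^*] of the domain of [p^* a] is a product with factors [p^* 0] and [p^* a];
   towards the first one everything factors through the zero object. *)
Lemma pstar_extension_pstar (a : A) : pstar_extension (pstar ch a) = s a.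
Proof.
  apply slice_unit_image_mono; rewrite pstar_extension_unit.
  apply pstar_pstar_jointly_mono.
  - rewrite <- !cmp_assoc, <- (s_nat (slice_map (pstar ch a))), cmp_assoc.
    rewrite <- !fmap_cmp, slice_unit_map, !fmap_cmp.
    destruct (G_pt_terminal (F (slice_one (zero ch)))) as [b _].
    rewrite !cmp_assoc.
    rewrite (terminal_eq (fmap G (slice_bang (pstar ch a)) ∘ s a)
               (b ∘ fmap F (slice_bang (pstar ch a))) G_pt_terminal), <- !cmp_assoc.
    apply zero_cmp_eq; assumption.
  - rewrite <- !cmp_assoc, <- (s_nat (pstar_snd ch a)), cmp_assoc.
    rewrite <- !fmap_cmp, pstar_snd_unit, !fmap_id, cmp_idl; apply cmp_idr.
Qed.

(** For uniqueness, naturality at [slice_unit x] forces the equation that characterizes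
    [pstar_extension x]. *)
Lemma pstar_fully_faithful :
  exists! t : NatTrans F G, forall a, t (pstar ch a) = s a.
Proof.
  exists {| nt_nat := pstar_extension_nat |}; split; [exact pstar_extension_pstar|].
  intros t Ht; apply nat_trans_eq; intro x; apply slice_unit_image_mono; simpl.
  rewrite pstar_extension_unit, <- (Ht (slice_dom x)); apply nt_nat.
Qed.

End PstarFullyFaithful.

(** Pointwise inverses, picked by choice, are natural because [s] is. *)
Lemma componentwise_iso (A B : Category) (F G : Functor A B)
  (s : forall x, hom (F x) (G x)) :
  (forall x y (f : hom x y), s y ∘ fmap F f = fmap G f ∘ s x) ->
  (forall x, exists t, s x ∘ t = idm (G x) /\ t ∘ s x = idm (F x)) ->
  inhabited (Iso (C := FunCat A B) F G).
Proof.
  intros Hs Ht.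
  pose (t := fun x => proj1_sig (constructive_indefinite_description _ (Ht x))).
  assert (H : forall x, s x ∘ t x = idm (G x) /\ t x ∘ s x = idm (F x))
    by (intro x; exact (proj2_sig (constructive_indefinite_description _ (Ht x)))).
  constructor; apply (@nat_iso_id A B F G s t Hs).
  - intros x y f.
    rewrite <- (cmp_idr (t y ∘ fmap G f)), <- (proj1 (H x)), !cmp_assoc.
    rewrite <- (cmp_assoc (fmap G f)), <- Hs, <- !cmp_assoc, (proj2 (H y)), cmp_idl.
    reflexivity.
  - apply H.
  - apply H.
Qed.

(** * Extending a left-exact functor along [p^*] by kernels *)

Section PstarExtension.
Context (A : Category) (ch : Chosen A) (Y : Category) (chY : Chosen Y) (HY : Pointed Y).
Context (H : Functor A Y) (HH : LeftExact H).

Let zero_terminal : IsTerminal (zero chY).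
Proof. exact (pointed_zero_terminal HY (zero_initial chY)). Qed.

Let m : hom (zero chY) (H (zero ch)) := the (zero_initial chY (H (zero ch))).

(** Since [zero chY] is a zero object, pulling back along [m] takes the kernel of the image under
    [H] of the structure map. *)
Definition pstar_kernel : Functor (Slice (zero ch)) Y :=
  functor_comp (slice_forget (zero chY))
    (functor_comp (pullback_functor chY m) (slice_functor H (zero ch))).

Definition kernel_map (x : Slice (zero ch)) : hom (pstar_kernel x) (H (slice_dom x)) :=
  pb2 (pullback chY m (fmap H (slice_map x))).

Lemma kernel_map_cmp (x y : Slice (zero ch)) (h : hom x y) (w : Y)
  (u : hom w (pstar_kernel x)) :
  kernel_map y ∘ (fmap pstar_kernel h ∘ u) = fmap H (slice_hom h) ∘ (kernel_map x ∘ u).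
Proof.
  rewrite <- !cmp_assoc; apply (f_equal (fun e => e ∘ u)).
  exact (pullback_hom_pb2 chY m (fmap (slice_functor H (zero ch)) h)).
Qed.

(** The other pullback projection lands in a terminal object and carries no information. *)
Lemma kernel_map_mono (x : Slice (zero ch)) (w : Y) (u v : hom w (pstar_kernel x)) :
  kernel_map x ∘ u = kernel_map x ∘ v -> u = v.
Proof. intro e; apply pb_uniq; [apply terminal_eq, zero_terminal | exact e]. Qed.

Lemma kernel_map_zero (x : Slice (zero ch)) (w : Y) (k : hom w (pstar_kernel x))
  (b : hom w (zero chY)) :
  fmap H (slice_map x) ∘ (kernel_map x ∘ k) = m ∘ b.
Proof.
  etransitivity; [symmetry; apply cmp_assoc|].
  etransitivity; [apply (f_equal (fun e => e ∘ k)); symmetry; apply pb_comm|].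
  rewrite cmp_assoc; f_equal; apply terminal_eq, zero_terminal.
Qed.

Lemma kernel_map_lift (x : Slice (zero ch)) (w : Y) (b : hom w (zero chY))
  (k : hom w (H (slice_dom x))) :
  m ∘ b = fmap H (slice_map x) ∘ k ->
  exists u : hom w (pstar_kernel x), kernel_map x ∘ u = k.
Proof.
  intro e; destruct (pb_univ (pullback chY m (fmap H (slice_map x))) e) as [u [[_ Hu] _]].
  exists u; exact Hu.
Qed.

(** A cone on the image of [D] gives, through the kernel inclusions, a cone on the image under [H]
    of [slice_diagram D] whose leg at [None] is zero. [H] preserves the limit of that diagram, and
    the factorization lifts to the kernel. *)
Lemma pstar_kernel_lex : LeftExact pstar_kernel.
Proof.
  intros J HJ D c Hc c'.
  destruct (zero_terminal (apex c')) as [b _].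
  pose (l := fun j : RightCone J =>
    match j return hom (apex c') (H (slice_diagram D j)) with
    | Some j => kernel_map (D j) ∘ leg c' j
    | None => m ∘ b end).
  assert (Hl : forall i j (q : hom i j),
    fmap (functor_comp H (slice_diagram D)) q ∘ l i = l j).
  { intros [i|] [j|] q; try contradiction q; simpl.
    - etransitivity; [symmetry; apply kernel_map_cmp|].
      f_equal; exact (leg_nat c' q).
    - apply kernel_map_zero.
    - rewrite fmap_id; apply cmp_idl. }
  destruct (HH (right_cone_finite HJ) (limit_slice_diagram Hc) (Build_Cone Hl))
    as [u [Hu Uu]].
  (* The equation at [None] says that [u] is killed by the structure map of the apex, as the lift
     requires. *)
  destruct (@kernel_map_lift (apex c) (apex c') b u (eq_sym (Hu None))) as [v Hv].
  exists v; split.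
  - intro j; apply kernel_map_mono; simpl leg.
    etransitivity; [apply kernel_map_cmp|]; rewrite Hv; exact (Hu (Some j)).
  - intros v' Hv'; apply kernel_map_mono; rewrite Hv; apply Uu; intros [j|].
    + etransitivity; [symmetry; apply kernel_map_cmp|].
      simpl leg; f_equal; exact (Hv' j).
    + apply kernel_map_zero.
Qed.

Let pi (a : A) : hom (pstar_kernel (pstar ch a)) (H a) :=
  fmap H (pstar_snd ch a) ∘ kernel_map (pstar ch a).

(** [H] preserves the product [0 x a], and the kernel of the first projection of a product is its
    second factor. *)
Lemma pstar_kernel_product (a : A) :
  exists j : hom (H a) (pstar_kernel (pstar ch a)),
    pi a ∘ j = idm (H a) /\ j ∘ pi a = idm (pstar_kernel (pstar ch a)).
Proof.
  pose (q := pullback ch (the (zero_initial ch (one ch))) (slice_map (to_slice_one ch a))).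
  destruct (zero_terminal (H a)) as [b _].
  (* [u] has the zero map and the identity as components; its zero component lets it lift to the
     kernel as [j]. *)
  destruct (terminal_product (lex_pullback HH q) (m ∘ b) (idm (H a))
    (lex_terminal HH (one_terminal ch))) as [u [H1 H2]].
  destruct (@kernel_map_lift (pstar ch a) (H a) b u (eq_sym H1)) as [j Hj].
  assert (e : pi a ∘ j = idm (H a)) by (unfold pi; rewrite cmp_assoc, Hj; exact H2).
  exists j; split; [exact e|].
  apply kernel_map_mono; rewrite <- cmp_assoc, Hj, cmp_idr.
  (* Compared on the two projections of the product: both maps are zero on the first and [pi a] on
     the second. *)
  apply (pb_uniq (p := lex_pullback HH q)).
  - etransitivity; [symmetry; apply cmp_assoc|].
    etransitivity; [apply (f_equal (fun e => e ∘ pi a)), H1|].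
    rewrite cmp_assoc; symmetry; etransitivity; [apply f_equal; symmetry; apply cmp_idr|].
    apply (kernel_map_zero (x := pstar ch a)).
  - etransitivity; [symmetry; apply cmp_assoc|].
    etransitivity; [apply (f_equal (fun e => e ∘ pi a)), H2|].
    apply cmp_idl.
Qed.

Lemma pstar_kernel_pstar :
  inhabited (Iso (C := FunCat A Y) (functor_comp pstar_kernel (pstar ch)) H).
Proof.
  apply (@componentwise_iso A Y (functor_comp pstar_kernel (pstar ch)) H pi).
  - intros a a' f; unfold pi.
    change (fmap (functor_comp pstar_kernel (pstar ch)) f)
      with (fmap pstar_kernel (fmap (pstar ch) f)).
    rewrite <- (cmp_idr (fmap pstar_kernel (fmap (pstar ch) f))), cmp_assoc.
    rewrite kernel_map_cmp, cmp_idr.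
    rewrite <- !cmp_assoc, <- !fmap_cmp, pstar_snd_nat; reflexivity.
  - exact pstar_kernel_product.
Qed.

End PstarExtension.

(** * Universal arrows and biadjunctions *)

Definition FullyFaithful (A B : Category) (F : Functor A B) : Prop :=
  forall (x y : A) (g : hom (F x) (F y)), exists! f : hom x y, fmap F f = g.

Definition EssentiallySurjective (A B : Category) (F : Functor A B) : Prop :=
  forall y : B, exists x : A, inhabited (Iso (F x) y).

Definition iso_sym (C : Category) (x y : C) (i : Iso x y) : Iso y x :=
  {| iso_fwd := iso_bwd i; iso_bwd := iso_fwd i;
     iso_bwd_fwd := iso_fwd_bwd i; iso_fwd_bwd := iso_bwd_fwd i |}.

Section FullyFaithful.
Context (A B : Category) (F : Functor A B) (HF : FullyFaithful F).

Definition ff_lift (x y : A) (g : hom (F x) (F y)) : hom x y := the (HF g).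

Lemma fmap_ff_lift (x y : A) (g : hom (F x) (F y)) : fmap F (ff_lift g) = g.
Proof. exact (the_spec (HF g)). Qed.

Lemma ff_faithful (x y : A) (f f' : hom x y) : fmap F f = fmap F f' -> f = f'.
Proof. intro e; destruct (HF (fmap F f')) as [t [_ Ht]]; rewrite <- (Ht f e); auto. Qed.

Definition ff_lift_iso (x y : A) (i : Iso (F x) (F y)) : Iso x y.
Proof.
  refine {| iso_fwd := ff_lift i; iso_bwd := ff_lift (iso_bwd i) |};
    apply ff_faithful; rewrite fmap_cmp, !fmap_ff_lift, fmap_id.
  - apply iso_bwd_fwd.
  - apply iso_fwd_bwd.
Defined.

Lemma ff_eso_equivalence : EssentiallySurjective F -> IsEquivalence F.
Proof.
  intro HE.
  pose (pre := fun y => constructive_indefinite_description _ (HE y)).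
  pose (g := fun y => proj1_sig (pre y)).
  (* Restating [inhabited] as an existential lets choice extract the isomorphisms [e y]. *)
  assert (Hg : forall y, exists i : Iso (F (g y)) y, True).
  { intro y; destruct (proj2_sig (pre y)) as [i]; exists i; exact I. }
  pose (e := fun y => proj1_sig (constructive_indefinite_description _ (Hg y))).
  unshelve epose (G := @Build_Functor B A g
    (fun x y f => ff_lift (iso_bwd (e y) ∘ f ∘ e x)) _ _).
  { intro x; apply ff_faithful.
    rewrite fmap_ff_lift, cmp_idr, iso_bwd_fwd, fmap_id; reflexivity. }
  { intros x y z h f; apply ff_faithful; rewrite fmap_cmp, !fmap_ff_lift, !cmp_assoc.
    rewrite <- (cmp_assoc (e y)), iso_fwd_bwd, cmp_idl; reflexivity. }
  exists G; split.
  - apply (@componentwise_iso A A (functor_comp G F) (functor_id A)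
             (fun x => ff_lift (e (F x)))).
    + intros x y f; apply ff_faithful; simpl.
      rewrite !fmap_cmp, !fmap_ff_lift, <- !cmp_assoc, iso_fwd_bwd, cmp_idl; reflexivity.
    + intro x; exists (ff_lift (iso_bwd (e (F x)))).
      split; apply ff_faithful; simpl; rewrite fmap_cmp, !fmap_ff_lift, fmap_id.
      * apply iso_fwd_bwd.
      * apply iso_bwd_fwd.
  - apply (@componentwise_iso B B (functor_comp F G) (functor_id B) (fun y => e y)).
    + intros x y f; simpl.
      rewrite fmap_ff_lift, <- !cmp_assoc, iso_fwd_bwd, cmp_idl; reflexivity.
    + intro y; exists (iso_bwd (e y)); split; [apply iso_fwd_bwd | apply iso_bwd_fwd].
Qed.

End FullyFaithful.

Definition precomp (C : Bicategory) (x y z : C) (f : bhom x y) :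
  Functor (bhom y z) (bhom x z).
Proof.
  refine (@Build_Functor (bhom y z) (bhom x z) (fun g => g ⊙ f)
            (fun g g' b => b ⋆ idm f) _ _).
  - intro g; apply hcmp_id.
  - intros; apply whisker_r_cmp.
Defined.

Definition postcomp (C : Bicategory) (x y z : C) (g : bhom y z) :
  Functor (bhom x y) (bhom x z).
Proof.
  refine (@Build_Functor (bhom x y) (bhom x z) (fun f => g ⊙ f)
            (fun f f' a => idm g ⋆ a) _ _).
  - intro f; apply hcmp_id.
  - intros; apply whisker_l_cmp.
Defined.

Lemma cmp_step (C : Category) (w x y z : C) (g : hom y z) (f : hom x y) (h : hom x z)
  (k : hom w x) : g ∘ f = h -> g ∘ (f ∘ k) = h ∘ k.
Proof. intros <-; symmetry; apply cmp_assoc. Qed.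
Arguments cmp_step {C w x y z g f h} k _.

(** Shaped for the right-hand side of [pst_cmp], whose leftmost factor becomes an identity in
    [extension_unit]. *)
Lemma cmp_assoc_idl (C : Category) (u v w x y z : C) (i : hom z z) (a : hom y z)
  (b : hom x y) (c : hom w x) (d : hom v w) (e : hom u v) :
  i = idm z -> i ∘ a ∘ b ∘ c ∘ d ∘ e = a ∘ (b ∘ (c ∘ (d ∘ e))).
Proof. intros ->; rewrite cmp_idl, !cmp_assoc; reflexivity. Qed.

(** * The pseudofunctor and the biadjunction unit induced by universal arrows *)

Section UniversalArrows.
Context (P : Lex0 -> Prop) (L : Lex0 -> FullSub P).
Context (eta : forall A : Lex0, bhom A (proj1_sig (L A))).
Context (eta_ff : forall (A : Lex0) (Y : FullSub P),
  FullyFaithful (precomp (proj1_sig Y) (eta A))).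
Context (eta_es : forall (A : Lex0) (Y : FullSub P),
  EssentiallySurjective (precomp (proj1_sig Y) (eta A))).

Let K (A : Lex0) : Lex0 := proj1_sig (L A).

(** Essential surjectivity applied to [eta B ⊙ f]. The sigma type lets the 1-cell and its invertible
    2-cell be chosen together. *)
Lemma extension_ex (A B : Lex0) (f : bhom A B) :
  exists g : {g : bhom (K A) (K B) & Iso (g ⊙ eta A) (eta B ⊙ f)}, True.
Proof.
  destruct (@eta_es A (L B) (eta B ⊙ f)) as [g [i]].
  exists (existT _ g i); exact I.
Qed.

Definition extension (A B : Lex0) (f : bhom A B) : bhom (K A) (K B) :=
  projT1 (proj1_sig (constructive_indefinite_description _ (extension_ex f))).

Definition extension_iso (A B : Lex0) (f : bhom A B) :
  Iso (extension f ⊙ eta A) (eta B ⊙ f) :=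
  projT2 (proj1_sig (constructive_indefinite_description _ (extension_ex f))).

(** Gives 2-cells of [Lex0] components in plain categories, where constraint cells become identities
    and whiskering becomes [fmap] or evaluation. *)
Definition ev (A B : Lex0) (F G : bhom A B) (s : hom F G) (x : lex0_cat A) :
  hom (lex0_functor F x) (lex0_functor G x) := nt s x.

Lemma ev_nat (A B : Lex0) (F G : bhom A B) (s : hom F G) (x y : lex0_cat A)
  (f : hom x y) :
  ev s y ∘ fmap (lex0_functor F) f = fmap (lex0_functor G) f ∘ ev s x.
Proof. exact (nt_nat s f). Qed.

Lemma ev_eq (A B : Lex0) (F G : bhom A B) (s t : hom F G) :
  s = t -> forall x, ev s x = ev t x.
Proof. intros -> x; reflexivity. Qed.

Lemma ev_iso_mono (A B : Lex0) (F G : bhom A B) (i : Iso F G) (x : lex0_cat A)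
  (w : lex0_cat B) (u v : hom w (lex0_functor F x)) :
  ev i x ∘ u = ev i x ∘ v -> u = v.
Proof.
  intro e; rewrite <- (cmp_idl u), <- (cmp_idl v).
  assert (H : ev (iso_bwd i) x ∘ ev i x = idm (lex0_functor F x))
    by exact (ev_eq (iso_bwd_fwd i) x).
  rewrite <- H, !cmp_assoc, e; reflexivity.
Qed.

Lemma whisker_eta (A B : Lex0) (F G : bhom (K A) B) (s : hom F G) (x : lex0_cat A) :
  ev (s ⋆ idm (eta A)) x = ev s (lex0_functor (eta A) x).
Proof.
  change (ev s (lex0_functor (eta A) x) ∘
    fmap (lex0_functor F) (idm (lex0_functor (eta A) x)) = ev s (lex0_functor (eta A) x)).
  rewrite fmap_id; apply cmp_idr.
Qed.

(** Precomposition with [eta A] is faithful and [extension_iso f] is invertible. The functor and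
    coherence laws below are all tested in this way. *)
Lemma extension_cell_eq (A B : Lex0) (f : bhom A B) (g : bhom (K A) (K B))
  (s t : hom g (extension f)) :
  (forall x, ev (extension_iso f) x ∘ ev s (lex0_functor (eta A) x) =
             ev (extension_iso f) x ∘ ev t (lex0_functor (eta A) x)) -> s = t.
Proof.
  intro H; apply (ff_faithful (@eta_ff A (L B))), nat_trans_eq; intro x.
  change (ev (s ⋆ idm (eta A)) x = ev (t ⋆ idm (eta A)) x).
  rewrite !whisker_eta; exact (ev_iso_mono (H x)).
Qed.

(** The unique 2-cell for which [extension_iso] is natural in [f]. *)
Definition extension_cell (A B : Lex0) (f f' : bhom A B) (a : hom f f') :
  hom (extension f) (extension f') :=
  ff_lift (@eta_ff A (L B)) (x := extension f) (y := extension f')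
    (iso_bwd (extension_iso f') ∘ ((idm (eta B) ⋆ a) ∘ extension_iso f)).

Lemma extension_cell_whisker (A B : Lex0) (f f' : bhom A B) (a : hom f f') :
  extension_iso f' ∘ (extension_cell a ⋆ idm (eta A)) =
  (idm (eta B) ⋆ a) ∘ extension_iso f.
Proof.
  etransitivity; [apply f_equal, (fmap_ff_lift (@eta_ff A (L B)))|].
  rewrite <- cmp_assoc, iso_fwd_bwd; apply cmp_idl.
Qed.

Lemma extension_cell_ev (A B : Lex0) (f f' : bhom A B) (a : hom f f') (x : lex0_cat A) :
  ev (extension_iso f') x ∘ ev (extension_cell a) (lex0_functor (eta A) x) =
  fmap (lex0_functor (eta B)) (ev a x) ∘ ev (extension_iso f) x.
Proof.
  rewrite <- whisker_eta.
  etransitivity; [exact (ev_eq (extension_cell_whisker a) x)|].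
  change (idm _ ∘ fmap (lex0_functor (eta B)) (ev a x) ∘ ev (extension_iso f) x =
    fmap (lex0_functor (eta B)) (ev a x) ∘ ev (extension_iso f) x).
  rewrite cmp_idl; reflexivity.
Qed.

(** The squares of [f] and [g] pasted side by side, with the associators in the places that
    [pst_cmp] prescribes. *)
Definition extension_paste (A B C : Lex0) (g : bhom B C) (f : bhom A B) :
  Iso (extension g ⊙ extension f ⊙ eta A) (eta C ⊙ (g ⊙ f)) :=
  iso_trans (assoc (eta C) g f)
    (iso_trans (iso_map (precomp _ f) (extension_iso g))
      (iso_trans (iso_sym (assoc (extension g) (eta B) f))
        (iso_trans (iso_map (postcomp _ (extension g)) (extension_iso f))
           (assoc (extension g) (extension f) (eta A))))).

Lemma extension_paste_fwd (A B C : Lex0) (g : bhom B C) (f : bhom A B) :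
  iso_fwd (extension_paste g f) =
  assoc (eta C) g f ∘ ((extension_iso g ⋆ idm f) ∘
    (iso_bwd (assoc (extension g) (eta B) f) ∘
      ((idm (extension g) ⋆ extension_iso f) ∘ assoc (extension g) (extension f) (eta A)))).
Proof.
  unfold extension_paste; cbn [iso_fwd iso_bwd iso_trans iso_map iso_sym].
  cbn [fmap precomp postcomp]; reflexivity.
Qed.

Lemma extension_paste_ev (A B C : Lex0) (g : bhom B C) (f : bhom A B) (x : lex0_cat A) :
  ev (extension_paste g f) x =
  ev (extension_iso g) (lex0_functor f x) ∘
    fmap (lex0_functor (extension g)) (ev (extension_iso f) x).
Proof.
  unfold extension_paste; cbn.
  rewrite !fmap_id, !cmp_idl, !cmp_idr; reflexivity.
Qed.

(** The unique 2-cell that carries the square of [g ⊙ f] to the pasted square. *)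
Definition extension_cmp (A B C : Lex0) (g : bhom B C) (f : bhom A B) :
  Iso (extension g ⊙ extension f) (extension (g ⊙ f)) :=
  ff_lift_iso (@eta_ff A (L C)) (x := extension g ⊙ extension f)
    (y := extension (g ⊙ f))
    (iso_trans (iso_sym (extension_iso (g ⊙ f))) (extension_paste g f)).

Lemma extension_cmp_whisker (A B C : Lex0) (g : bhom B C) (f : bhom A B) :
  extension_iso (g ⊙ f) ∘ (extension_cmp g f ⋆ idm (eta A)) = extension_paste g f.
Proof.
  etransitivity; [apply f_equal, (fmap_ff_lift (@eta_ff A (L C)))|].
  etransitivity; [symmetry; apply cmp_assoc|].
  rewrite iso_fwd_bwd; apply cmp_idl.
Qed.

Lemma extension_cmp_ev (A B C : Lex0) (g : bhom B C) (f : bhom A B) (x : lex0_cat A) :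
  ev (extension_iso (g ⊙ f)) x ∘ ev (extension_cmp g f) (lex0_functor (eta A) x) =
  ev (extension_iso g) (lex0_functor f x) ∘
    fmap (lex0_functor (extension g)) (ev (extension_iso f) x).
Proof.
  rewrite <- extension_paste_ev, <- whisker_eta.
  exact (ev_eq (extension_cmp_whisker g f) x).
Qed.

Definition extension_id (A : Lex0) : Iso (id1 (K A)) (extension (id1 A)) :=
  ff_lift_iso (@eta_ff A (L A)) (x := id1 (K A)) (y := extension (id1 A))
    (iso_trans (iso_sym (extension_iso (id1 A)))
      (iso_trans (iso_sym (runit (eta A))) (lunit (eta A)))).

Lemma extension_id_whisker (A : Lex0) :
  extension_iso (id1 A) ∘ (extension_id A ⋆ idm (eta A)) =
  iso_bwd (runit (eta A)) ∘ lunit (eta A).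
Proof.
  etransitivity; [apply f_equal, (fmap_ff_lift (@eta_ff A (L A)))|].
  etransitivity; [symmetry; apply cmp_assoc|].
  rewrite iso_fwd_bwd; apply cmp_idl.
Qed.

Lemma extension_id_ev (A : Lex0) (x : lex0_cat A) :
  ev (extension_iso (id1 A)) x ∘ ev (extension_id A) (lex0_functor (eta A) x) =
  idm (lex0_functor (eta A) x).
Proof.
  rewrite <- whisker_eta.
  etransitivity; [exact (ev_eq (extension_id_whisker A) x)|].
  apply cmp_idl.
Qed.

Definition extension_functor (A B : Lex0) : Functor (bhom A B) (bhom (K A) (K B)).
Proof.
  refine (@Build_Functor (bhom A B) (bhom (K A) (K B)) (@extension A B)
            (@extension_cell A B) _ _).
  - intro f; apply extension_cell_eq; intro x; rewrite extension_cell_ev.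
    change (fmap (lex0_functor (eta B)) (idm (lex0_functor f x)) ∘ ev (extension_iso f) x =
      ev (extension_iso f) x ∘ idm (lex0_functor (extension f) (lex0_functor (eta A) x))).
    rewrite fmap_id, cmp_idr; apply cmp_idl.
  - intros f f' f'' b a; apply extension_cell_eq; intro x; rewrite extension_cell_ev.
    change (fmap (lex0_functor (eta B)) (ev b x ∘ ev a x) ∘ ev (extension_iso f) x =
      ev (extension_iso f'') x ∘ (ev (extension_cell b) (lex0_functor (eta A) x) ∘
        ev (extension_cell a) (lex0_functor (eta A) x))).
    etransitivity; [|symmetry; apply (cmp_step _ (extension_cell_ev b x))].
    rewrite fmap_cmp, !cmp_assoc; f_equal; symmetry; apply extension_cell_ev.
Defined.

Lemma extension_cmp_nat (A B C : Lex0) (g g' : bhom B C) (f f' : bhom A B)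
  (b : hom g g') (a : hom f f') :
  extension_cmp g' f' ∘ (extension_cell b ⋆ extension_cell a) =
  extension_cell (b ⋆ a) ∘ extension_cmp g f.
Proof.
  apply extension_cell_eq; intro x.
  change (ev (extension_iso (g' ⊙ f')) x ∘
    (ev (extension_cmp g' f') (lex0_functor (eta A) x) ∘
      (ev (extension_cell b) (lex0_functor (extension f') (lex0_functor (eta A) x)) ∘
       fmap (lex0_functor (extension g))
         (ev (extension_cell a) (lex0_functor (eta A) x)))) =
    ev (extension_iso (g' ⊙ f')) x ∘
    (ev (extension_cell (b ⋆ a)) (lex0_functor (eta A) x) ∘
     ev (extension_cmp g f) (lex0_functor (eta A) x))).
  (* The common value is the component of the pasted square of [g] and [f], followed by the image
     under [eta C] of the component of [b ⋆ a]. *)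
  transitivity (fmap (lex0_functor (eta C)) (ev b (lex0_functor f' x)) ∘
    (fmap (lex0_functor (eta C)) (fmap (lex0_functor g) (ev a x)) ∘
      (ev (extension_iso g) (lex0_functor f x) ∘
        fmap (lex0_functor (extension g)) (ev (extension_iso f) x)))).
  - etransitivity; [apply (cmp_step _ (extension_cmp_ev g' f' x))|].
    rewrite cmp_assoc.
    etransitivity;
      [apply f_equal, (cmp_extend (eq_sym (ev_nat (extension_cell b)
                                             (ev (extension_iso f') x))))|].
    etransitivity; [apply (cmp_step _ (extension_cell_ev b (lex0_functor f' x)))|].
    rewrite cmp_assoc; apply f_equal.
    rewrite <- fmap_cmp.
    etransitivity;
      [apply (f_equal (cmp _)), (f_equal (fmap (lex0_functor (extension g)))),
        extension_cell_ev|].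
    rewrite fmap_cmp; apply (cmp_extend (ev_nat (extension_iso g) (ev a x))).
  - symmetry.
    etransitivity; [apply (cmp_step _ (extension_cell_ev (b ⋆ a) x))|].
    change (ev (b ⋆ a) x) with (ev b (lex0_functor f' x) ∘ fmap (lex0_functor g) (ev a x)).
    rewrite fmap_cmp, !cmp_assoc; do 2 apply f_equal; apply extension_cmp_ev.
Qed.

Lemma extension_cmp_assoc (A B C D : Lex0) (h : bhom C D) (g : bhom B C) (f : bhom A B) :
  extension_cell (assoc h g f) ∘ extension_cmp (h ⊙ g) f ∘
    (extension_cmp h g ⋆ idm (extension f)) =
  extension_cmp h (g ⊙ f) ∘ (idm (extension h) ⋆ extension_cmp g f) ∘
    assoc (extension h) (extension g) (extension f).
Proof.
  apply extension_cell_eq; intro x.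
  pose (z := lex0_functor (eta A) x).
  change (ev (extension_iso (h ⊙ (g ⊙ f))) x ∘
    (ev (extension_cell (assoc h g f)) z ∘ ev (extension_cmp (h ⊙ g) f) z ∘
      (ev (extension_cmp h g) (lex0_functor (extension f) z) ∘
       fmap (lex0_functor (extension h)) (fmap (lex0_functor (extension g))
         (idm (lex0_functor (extension f) z))))) =
    ev (extension_iso (h ⊙ (g ⊙ f))) x ∘
    (ev (extension_cmp h (g ⊙ f)) z ∘
      (idm (lex0_functor (extension h) (lex0_functor (extension (g ⊙ f)) z)) ∘
       fmap (lex0_functor (extension h)) (ev (extension_cmp g f) z)) ∘
      idm (lex0_functor (extension h) (lex0_functor (extension g)
             (lex0_functor (extension f) z))))).
  rewrite !fmap_id, !cmp_idr, cmp_idl, !cmp_assoc.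
  (* Both sides reduce to the pasting of the three squares of [f], [g] and [h]. *)
  transitivity (ev (extension_iso h) (lex0_functor g (lex0_functor f x)) ∘
    fmap (lex0_functor (extension h))
      (ev (extension_iso g) (lex0_functor f x) ∘
        fmap (lex0_functor (extension g)) (ev (extension_iso f) x))).
  - etransitivity; [apply (cmp_step _ (extension_cell_ev (assoc h g f) x))|].
    change (ev (assoc h g f) x)
      with (idm (lex0_functor h (lex0_functor g (lex0_functor f x)))).
    rewrite fmap_id.
    etransitivity; [apply (f_equal (fun k => k ∘ _)), cmp_idl|].
    etransitivity; [apply (cmp_step _ (extension_cmp_ev (h ⊙ g) f x))|].
    rewrite cmp_assoc.
    etransitivity;
      [apply f_equal; symmetry; exact (ev_nat (extension_cmp h g) (ev (extension_iso f) x))|].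
    etransitivity; [apply (cmp_step _ (extension_cmp_ev h g (lex0_functor f x)))|].
    rewrite cmp_assoc, fmap_cmp; reflexivity.
  - symmetry.
    etransitivity; [apply (cmp_step _ (extension_cmp_ev h (g ⊙ f) x))|].
    rewrite cmp_assoc; apply f_equal.
    etransitivity; [exact (eq_sym (fmap_cmp (lex0_functor (extension h))
      (ev (extension_iso (g ⊙ f)) x) (ev (extension_cmp g f) z)))|].
    apply (f_equal (fmap (lex0_functor (extension h)))), extension_cmp_ev.
Qed.

Lemma extension_cmp_lunit (A B : Lex0) (f : bhom A B) :
  extension_cell (lunit f) ∘ extension_cmp (id1 B) f ∘
    (extension_id B ⋆ idm (extension f)) = lunit (extension f).
Proof.
  apply extension_cell_eq; intro x.
  pose (z := lex0_functor (eta A) x).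
  change (ev (extension_iso f) x ∘
    (ev (extension_cell (lunit f)) z ∘ ev (extension_cmp (id1 B) f) z ∘
      (ev (extension_id B) (lex0_functor (extension f) z) ∘
       idm (lex0_functor (extension f) z))) =
    ev (extension_iso f) x ∘ idm (lex0_functor (extension f) z)).
  rewrite !cmp_idr, !cmp_assoc.
  etransitivity; [apply (cmp_step _ (extension_cell_ev (lunit f) x))|].
  change (ev (lunit f) x) with (idm (lex0_functor f x)).
  rewrite fmap_id.
  etransitivity; [apply (f_equal (fun k => k ∘ _)), cmp_idl|].
  etransitivity; [apply (cmp_step _ (extension_cmp_ev (id1 B) f x))|].
  rewrite cmp_assoc.
  etransitivity;
    (* Naturality moves [extension_id B] to an object in the image of [eta B], where
       [extension_id_ev] computes it. *)
    [apply f_equal; symmetry; exact (ev_nat (extension_id B) (ev (extension_iso f) x))|].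
  etransitivity; [apply (cmp_step _ (extension_id_ev (lex0_functor f x)))|].
  apply cmp_idl.
Qed.

Lemma extension_cmp_runit (A B : Lex0) (f : bhom A B) :
  extension_cell (runit f) ∘ extension_cmp f (id1 A) ∘
    (idm (extension f) ⋆ extension_id A) = runit (extension f).
Proof.
  apply extension_cell_eq; intro x.
  pose (z := lex0_functor (eta A) x).
  change (ev (extension_iso f) x ∘
    (ev (extension_cell (runit f)) z ∘ ev (extension_cmp f (id1 A)) z ∘
      (idm (lex0_functor (extension f) (lex0_functor (extension (id1 A)) z)) ∘
       fmap (lex0_functor (extension f)) (ev (extension_id A) z))) =
    ev (extension_iso f) x ∘ idm (lex0_functor (extension f) z)).
  rewrite cmp_idl, cmp_idr, !cmp_assoc.
  etransitivity; [apply (cmp_step _ (extension_cell_ev (runit f) x))|].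
  change (ev (runit f) x) with (idm (lex0_functor f x)).
  rewrite fmap_id.
  etransitivity; [apply (f_equal (fun k => k ∘ _)), cmp_idl|].
  etransitivity; [apply (cmp_step _ (extension_cmp_ev f (id1 A) x))|].
  rewrite cmp_assoc.
  etransitivity; [apply f_equal; exact (eq_sym (fmap_cmp (lex0_functor (extension f))
    (ev (extension_iso (id1 A)) x) (ev (extension_id A) z)))|].
  etransitivity;
    [apply (f_equal (cmp _)), (f_equal (fmap (lex0_functor (extension f)))),
      extension_id_ev|].
  rewrite fmap_id; apply cmp_idr.
Qed.

Definition extension_psf : PseudofunctorOn (C := Lex0) (D := FullSub P) L :=
  @Build_PseudofunctorOn Lex0 (FullSub P) L extension_functor
    extension_cmp extension_id extension_cmp_nat extension_cmp_assoc
    extension_cmp_lunit extension_cmp_runit.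

(** The naturality cells are the chosen isomorphisms, and the axioms are the whiskering equations of
    the lifted cells. *)
Definition extension_unit :
  PseudoNat (psf_identity Lex0)
    (psf_compose (@full_inclusion Lex0 P) (Build_Pseudofunctor extension_psf)).
Proof.
  refine (@Build_PseudoNat Lex0 Lex0 (psf_identity Lex0)
    (psf_compose (@full_inclusion Lex0 P) (Build_Pseudofunctor extension_psf))
    eta extension_iso _ _ _).
  - exact extension_cell_whisker.
  - intro A.
    (* The inclusion contributes an identity constraint cell to the composite pseudofunctor. *)
    change (extension_iso (id1 A) ∘ ((extension_id A ∘ idm (id1 (K A))) ⋆ idm (eta A)) =
      (idm (eta A) ⋆ idm (id1 A)) ∘ iso_bwd (runit (eta A)) ∘ lunit (eta A)).
    rewrite cmp_idr, hcmp_id, cmp_idl; apply extension_id_whisker.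
  - intros A B C g f.
    change (extension_iso (g ⊙ f) ∘
      ((extension_cmp g f ∘ idm (extension g ⊙ extension f)) ⋆ idm (eta A)) =
      (idm (eta C) ⋆ idm (g ⊙ f)) ∘ assoc (eta C) g f ∘
      (extension_iso g ⋆ idm f) ∘ iso_bwd (assoc (extension g) (eta B) f) ∘
      (idm (extension g) ⋆ extension_iso f) ∘ assoc (extension g) (extension f) (eta A)).
    rewrite cmp_assoc_idl, <- extension_paste_fwd by apply hcmp_id.
    etransitivity; [|exact (extension_cmp_whisker g f)].
    exact (f_equal (fun s => extension_iso (g ⊙ f) ∘ (s ⋆ idm (eta A)))
             (cmp_idr (iso_fwd (extension_cmp g f)))).
Defined.

(** The inclusion acts as the identity on hom-categories, so [transpose] is precomposition with
    [eta A] by computation. *)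
Lemma extension_biadjunction : IsBiadjunctionUnit extension_unit.
Proof.
  intros A Y; apply ff_eso_equivalence.
  - exact (@eta_ff A Y).
  - exact (@eta_es A Y).
Qed.

End UniversalArrows.

(** * The biadjunction given by slices over initial objects *)

Theorem theorem1p1 (ch : forall A : Lex0, Chosen (lex0_cat A)) :
  exists (slice_lex : forall A : Lex0,
            FinitelyComplete (Slice (zero (ch A))) /\
            HasInitial (Slice (zero (ch A))))
         (slice_pointed : forall A : Lex0, Pointed (Slice (zero (ch A))))
         (S_on : PseudofunctorOn (C := Lex0) (D := LexStar)
                   (lexstar_ob slice_lex slice_pointed)),
    let S : Pseudofunctor Lex0 LexStar := Build_Pseudofunctor S_on in
    exists eta : PseudoNat (psf_identity Lex0) (psf_compose LexStar_incl S),
      (forall A : Lex0, lex0_functor (eta A) = pstar (ch A)) /\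
      IsBiadjunctionUnit eta.
Proof.
  assert (HP : forall A : Lex0, Pointed (Slice (zero (ch A))))
    by (intro A; apply slice_initial_pointed, zero_initial).
  assert (HK : forall A : Lex0, FinitelyComplete (Slice (zero (ch A))) /\
                               HasInitial (Slice (zero (ch A)))).
  { intro A; split; [apply slice_finitely_complete, (proj1 (proj2_sig A))|].
    destruct (HP A) as [z [Hz _]]; exists z; exact Hz. }
  pose (L := lexstar_ob HK HP).
  pose (eta := fun A : Lex0 =>
    exist _ (pstar (ch A)) (@pstar_lex _ (ch A)) : bhom A (proj1_sig (L A))).
  assert (Hff : forall (A : Lex0) (Y : LexStar),
    FullyFaithful (precomp (proj1_sig Y) (eta A))).
  { intros A Y F G s.
    destruct (pstar_fully_faithful (ch := ch A) (proj2_sig Y) (proj2_sig F)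
      (proj2_sig G) (s := ev s) (ev_nat s)) as [t [Ht Ut]].
    exists t; split.
    - apply nat_trans_eq; intro x.
      etransitivity; [apply (@whisker_eta _ L eta A (proj1_sig Y) F G t)|]; apply Ht.
    - intros t' Ht'; apply Ut; intro x.
      etransitivity; [symmetry; apply (@whisker_eta _ L eta A (proj1_sig Y) F G t')|].
      exact (ev_eq Ht' x). }
  assert (Hes : forall (A : Lex0) (Y : LexStar),
    EssentiallySurjective (precomp (proj1_sig Y) (eta A))).
  { intros A Y H.
    (* Kernels are formed with the pullbacks that [ch] chooses in the pointed target [Y]. *)
    pose (G := exist _ (pstar_kernel (ch A) (ch (proj1_sig Y)) (proj1_sig H))
      (@pstar_kernel_lex _ (ch A) _ (ch (proj1_sig Y)) (proj2_sig Y) _ (proj2_sig H))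
      : bhom (proj1_sig (L A)) (proj1_sig Y)).
    exists G.
    destruct (pstar_kernel_pstar (ch A) (ch (proj1_sig Y)) (proj2_sig Y) (proj2_sig H))
      as [i].
    constructor; exact (@full_iso _ _ (G ⊙ eta A) H i). }
  exists HK, HP, (extension_psf Hff Hes), (extension_unit Hff Hes).
  split; [reflexivity | apply extension_biadjunction].
Qed.
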